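(* Let $X$ be a finite $T_0$ topological space and let $F:X\multimap X$ be a lower semicontinuous multivalued map with closed and acyclic values. Let $L:\operatorname{Endo}(\mathrm{Mod})\to\operatorname{Auto}(\mathrm{Mod})$ be a fixed normal functor. Let $P=(P_1,P_2)$ be a pair of closed subspaces of $X$ with $P_2\subseteq P_1$ such that $$P_1\cap\bigl(\operatorname{cl}(F(P_1)\setminus P_1)\cup F(P_2)\bigr)\subseteq P_2 .$$ If $L(H_*(P),I_P)\neq 0\in\operatorname{Auto}(\mathrm{Mod})$, then $\operatorname{Inv}(P_1\setminus P_2)\neq\emptyset$.
   Context: Multivalued maps. A multivalued map $F:X\multimap Y$ assigns to each $x\in X$ a subset $F(x)\subseteq Y$; $F(A)=\bigcup_{a\in A}F(a)$. It has closed (acyclic) values if each $F(x)$ is closed (acyclic, i.e. non-empty with the singular homology of a point). It is lower semicontinuous if $\{x\in X: F(x)\subseteq H\}$ is closed for every closed $H\subseteq Y$. $\operatorname{cl}$ denotes closure. Singular homology is taken with coefficients in a fixed ring $R$. Dynamics. A full solution of $F$ in $A\subseteq X$ is a map $\sigma:\mathbb{Z}\to A$ with $\sigma(i+1)\in F(\sigma(i))$ for all $i$. $\operatorname{Inv}(A)$ is the set of all $x\in A$ such that some full solution in $A$ has $x$ among its values. Induced maps. A multivalued map of pairs $F:(X,A)\multimap(Y,B)$ of finite $T_0$ spaces is a multivalued map $F:X\multimap Y$ with $F(a)\subseteq B$ for all $a\in A$. If $x\in\operatorname{cl}x'$ implies $F(x)\subseteq F(x')$ (which holds for lower semicontinuous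 maps with closed values) and $F$ has acyclic values, then, identifying $F$ with its graph $\{(x,y)\in X\times Y: y\in F(x)\}$ (subspace of the product) and $F|_A^B$ with the graph of the restriction $A\multimap B$, the projection $p_1:(F,F|_A^B)\to(X,A)$ induces isomorphisms in homology, and one defines $F_*=(p_2)_*(p_1)_*^{-1}:H_*(X,A)\to H_*(Y,B)$, where $p_2:(F,F|_A^B)\to(Y,B)$ is the other projection. Index map. For $P$ as in the claim, put $\bar P=(\bar P_1,\bar P_2)$ with $\bar P_i=P_i\cup\operatorname{cl}(F(P_1)\setminus P_1)$, $i=1,2$. Then $F(P_i)\subseteq\bar P_i$, so $F$ restricts to a multivalued map of pairs $F_P:P\multimap\bar P$; and the inclusion $\iota_P:P\to\bar P$ induces an isomorphism in relative homology (because $\bar P_1\setminus\bar P_2=P_1\setminus P_2$). The index map is $I_P=(\iota_P)_*^{-1}\circ(F_P)_*:H_*(P_1,P_2)\to H_*(P_1,P_2)$; $H_*(P)$ means $H_*(P_1,P_2)$. Categories. $\mathrm{Mod}$ is the category of graded $R$-modules with degree-zero homomorphisms. For a category $\mathcal{E}$, $\operatorname{Endo}(\mathcal{E})$ has objects $(A,a)$ with $a:A\to A$ in $\mathcal{E}$, and morphisms $(A,a)\to(B,b)$ are the morphisms $\varphi:A\to B$ of $\mathcal{E}$ with $\varphi a=b\varphi$. $\operatorname{Auto}(\mathcal{E})$ is the subcategory of those $(A,a)$ with $a$ an automorphism. A functor $L:\operatorname{Endo}(\mathcal{E})\to\mathcal{C}$ is normal if for every object $(A,a)$, $L$ sends the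 morphism $a:(A,a)\to(A,a)$ to an isomorphism. $0\in\operatorname{Auto}(\mathrm{Mod})$ denotes the zero module with its unique automorphism.
   Formalization: The normal functor L is additionally assumed to satisfy L(0) = 0 up to isomorphism; without this the claim fails, e.g. for a constant nonzero L and P = (∅, ∅). ''≠ 0'' is read as ''not isomorphic to 0''. *)

(* Defs.v *)
From HB Require Import structures.
From mathcomp Require Import all_boot all_order all_algebra generic_quotient.
From mathcomp Require Import ring_quotient.
From mathcomp Require Import all_classical all_reals topology normedtype.
From mathcomp Require Import freeg.

Set Implicit Arguments.
Unset Strict Implicit.
Unset Printing Implicit Defensive.

Import Order.TTheory GRing.Theory Num.Theory.
Import numFieldNormedType.Exports.
Import Quotient.

Local Open Scope classical_set_scope.
Local Open Scope ring_scope.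
Local Open Scope quotient_scope.

Section Subquotient.
Variables (R : nzRingType) (V : lmodType R) (Z B : submodClosed V).

Definition submod : Type := {z : V | z \in Z}.
HB.instance Definition _ := SubChoice.on submod.
HB.instance Definition _ := [SubChoice_isSubLmodule of submod by <:].

Definition submod_rel : {pred submod} := fun z => val z \in B.

Lemma submod_rel_closed : submod_closed submod_rel.
Proof.
split=> [|a u v Bu Bv].
  by rewrite -topredE /= /submod_rel raddf0 rpred0.
by rewrite -topredE /= /submod_rel linearP rpredD ?rpredZ.
Qed.
HB.instance Definition _ :=
  GRing.isSubmodClosed.Build R submod submod_rel submod_rel_closed.

(* The module Z / (Z `&` B). *)
Definition subquot : Type := {quot submod_rel}.
HB.instance Definition _ := GRing.Zmodule.on subquot.
HB.instance Definition _ := EqQuotient.on subquot.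

Lemma subquotP (x y : submod) :
  \pi_subquot x = \pi_subquot y <-> val (x - y) \in B.
Proof. by rewrite (rwP eqP) -(@idealrBE _ submod_rel). Qed.

Lemma subquot_pi0 : \pi_subquot 0 = 0.
Proof. exact: (@pi_zeror _ _ _ _ _ {quot submod_rel}). Qed.
Lemma subquot_piD (x y : submod) :
  \pi_subquot (x + y) = \pi_subquot x + \pi_subquot y.
Proof. exact: (@pi_addr _ _ _ _ _ {quot submod_rel}). Qed.

Definition subquot_scale (a : R) (x : subquot) : subquot :=
  \pi_subquot (a *: repr x).

Lemma subquot_piZ a (x : submod) :
  \pi_subquot (a *: x) = subquot_scale a (\pi_subquot x).
Proof.
apply/subquotP; rewrite -scalerBr linearZ; apply: rpredZ.
by apply/subquotP; rewrite reprK.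
Qed.

Lemma subquot_scaleA a b x :
  subquot_scale a (subquot_scale b x) = subquot_scale (a * b) x.
Proof. by rewrite /subquot_scale -scalerA [RHS]subquot_piZ. Qed.
Lemma subquot_scale1 : left_id 1 subquot_scale.
Proof. by move=> x; rewrite /subquot_scale scale1r reprK. Qed.
Lemma subquot_scaleDr : right_distributive subquot_scale +%R.
Proof.
move=> a x y; rewrite -[x]reprK -[y]reprK -subquot_piD -!subquot_piZ.
by rewrite -subquot_piD scalerDr.
Qed.
Lemma subquot_scaleDl x :
  {morph (subquot_scale)^~ x : a b / a + b}.
Proof. by move=> a b; rewrite /subquot_scale scalerDl subquot_piD. Qed.
HB.instance Definition _ := GRing.Zmodule_isLmodule.Build R subquot
  subquot_scaleA subquot_scale1 subquot_scaleDr subquot_scaleDl.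

End Subquotient.

Section SubquotientMap.
Variables (R : nzRingType) (V W : lmodType R) (f : {linear V -> W}).
Variables (Z B : submodClosed V) (Z' B' : submodClosed W).
Hypothesis fZ : forall v, v \in Z -> f v \in Z'.
Hypothesis fB : forall v, v \in B -> f v \in B'.

Definition submod_map (z : submod Z) : submod Z' :=
  Sub (f (val z)) (fZ (valP z)).

Definition subquot_map_fun (x : subquot Z B) : subquot Z' B' :=
  \pi_(subquot Z' B') (submod_map (repr x)).

Lemma subquot_map_fun_pi (z : submod Z) :
  subquot_map_fun (\pi_(subquot Z B) z) = \pi_(subquot Z' B') (submod_map z).
Proof.
apply/subquotP; set y := repr _.
have -> : val (submod_map y - submod_map z) = f (val (y - z)).
  by rewrite !raddfB.
by apply/fB/subquotP; rewrite reprK.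
Qed.

Lemma subquot_map_fun_linear : linear subquot_map_fun.
Proof.
move=> a x y; rewrite -[x]reprK -[y]reprK.
rewrite -[a *: \pi_(subquot Z B) _]subquot_piZ -subquot_piD.
rewrite !subquot_map_fun_pi -[a *: _ in RHS]subquot_piZ -subquot_piD.
by congr (\pi_(subquot Z' B') _); apply: val_inj; rewrite /= !linearP.
Qed.
HB.instance Definition _ := GRing.isLinear.Build R _ _ _ subquot_map_fun
  subquot_map_fun_linear.

Definition subquot_map : {linear subquot Z B -> subquot Z' B'} :=
  subquot_map_fun.

End SubquotientMap.

Section LinearInverse.
Variables (R : nzRingType) (U V : lmodType R) (f : {linear U -> V}).

Definition linv_fun (v : V) : U :=
  if `[< bijective f >] then xget 0 [set u | f u = v] else 0.

Lemma linv_fun_linear : linear linv_fun.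
Proof.
move=> a x y; rewrite /linv_fun; case: asboolP => [[g fK gK]|_]; last first.
  by rewrite scaler0 addr0.
have E v : xget 0 [set u | f u = v] = g v.
  by apply: xget_unique => [|u /= <-]; rewrite ?gK ?fK.
by rewrite !E -[LHS]fK; apply: (can_inj fK); rewrite !gK linearP !gK.
Qed.
HB.instance Definition _ := GRing.isLinear.Build R _ _ _ linv_fun
  linv_fun_linear.

(* By convention the inverse is 0 if f is not bijective. *)
Definition linv : {linear V -> U} := linv_fun.

End LinearInverse.

Section Simplex.
Variable K : realType.

Definition std_simplex n : set 'rV[K]_n.+1 :=
  [set t | (forall i, 0 <= t 0 i) /\ \sum_i t 0 i = 1].
Arguments std_simplex : clear implicits.

Definition face_mx n (i : 'I_n.+2) (t : 'rV[K]_n.+1) : 'rV[K]_n.+2 :=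
  \row_j oapp (t 0) 0 (unlift i j).

Lemma face_mx_simplex n i t : std_simplex n t -> std_simplex n.+1 (face_mx i t).
Proof.
move=> [t0 t1]; split=> [j|].
  by rewrite mxE; case: unlift => //= k.
rewrite (bigD1_ord i) //= mxE unlift_none /= add0r -[RHS]t1.
by apply: eq_bigr => k _; rewrite mxE liftK.
Qed.

Lemma face_mx_continuous n (i : 'I_n.+2) : continuous (@face_mx n i).
Proof.
move=> t A [P Pt PA].
exists (fun a k => P 0 (fintype.lift i k)) => [a k|s sP].
  by have := Pt 0 (fintype.lift i k); rewrite mxE liftK (ord1 a).
apply: PA => a j; rewrite (ord1 a) mxE.
case: unliftP => [k ->|->] /=; first exact: sP.
by have := nbhs_singleton (Pt 0 i); rewrite mxE unlift_none.
Qed.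

Definition face_fun n (i : 'I_n.+2) (t : std_simplex n) : std_simplex n.+1 :=
  SigSub (mem_set (face_mx_simplex i (set_mem (valP t)))).

Lemma face_fun_continuous n (i : 'I_n.+2) : continuous (@face_fun n i).
Proof.
apply: continuous_comp_initial => t.
apply: (@continuous_comp _ _ _ (@set_val _ (std_simplex n)) (face_mx i)).
  exact: initial_continuous.
exact: face_mx_continuous.
Qed.

Definition face n (i : 'I_n.+2) :
    continuousType (std_simplex n) (std_simplex n.+1) :=
  mkcts (@face_fun_continuous n i).

Definition singular_simplex (X : topologicalType) n :=
  continuousType (std_simplex n) X.

End Simplex.
Arguments std_simplex : clear implicits.

Section FreeModule.
Variable R : nzRingType.

Lemma fglift_linear (S : choiceType) (M : lmodType R) (f : S -> M) :
  linear (fglift f).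
Proof.
move=> a c d.
have fB u v : fglift f (u - v) = fglift f u - fglift f v.
  exact: lift_is_additive.
have f0 : fglift f 0 = 0 by rewrite -(subrr 0) fB subrr.
have fD : {morph fglift f : u v / u + v}.
  by move=> u v; rewrite -{1}[v]opprK fB -(sub0r v) fB f0 sub0r opprK.
rewrite fD; congr (_ + _).
have fsum r (F : S -> {freeg S / R}) :
    fglift f (\sum_(x <- r) F x) = \sum_(x <- r) fglift f (F x).
  exact: (big_morph (fglift f) fD f0).
rewrite -[c in RHS]freeg_sumE fsum scaler_sumr fsum.
by apply: eq_bigr => x _; rewrite !liftU scalerA.
Qed.
HB.instance Definition _ (S : choiceType) (M : lmodType R) (f : S -> M) :=
  GRing.isLinear.Build R {freeg S / R} M *:%R (fglift f) (fglift_linear f).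

Lemma freeg_linear_ext (S : choiceType) (M : lmodType R)
    (f g : {linear {freeg S / R} -> M}) :
  (forall s, f << s >> = g << s >>) -> f =1 g.
Proof.
move=> fg c; rewrite -[c]freeg_sumE !linear_sum; apply: eq_bigr => s _.
have -> : << coeff s c *g s >> = coeff s c *: << s >> :> {freeg S / R}.
  by apply/eqP/freeg_eqP => t; rewrite coeffZ !coeffU mul1r.
by rewrite !linearZ fg.
Qed.

End FreeModule.

Section Homology.
Variables (K : realType) (R : nzRingType).

Definition chain (X : topologicalType) n := {freeg (singular_simplex K X n) / R}.

Definition boundary (X : topologicalType) n :
    {linear chain X n -> chain X n.-1} :=
  match n with
  | 0 => \0
  | m.+1 => fglift (fun s : singular_simplex K X m.+1 =>
      \sum_(i < m.+2) (-1) ^+ i *: << (s \o face K i : singular_simplex K X m) >>)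
  end.

Definition chains_in (X : topologicalType) (A : set X) n : {pred chain X n} :=
  fun c => `[< forall s, coeff s c != 0 -> range s `<=` A >].
Arguments chains_in {X} A n.

Lemma chains_inP (X : topologicalType) (A : set X) n (c : chain X n) :
  reflect (forall s, coeff s c != 0 -> range s `<=` A) (c \in chains_in A n).
Proof. exact: asboolP. Qed.

Lemma chains_in_closed (X : topologicalType) (A : set X) n :
  submod_closed (chains_in A n).
Proof.
split=> [|a c d /chains_inP cA /chains_inP dA].
  by apply/chains_inP => s; rewrite coeff0 eqxx.
apply/chains_inP => s; rewrite coeffD coeffZ.
have [/eqP|c0 _] := boolP (coeff s c == 0); last exact: cA.
by move=> ->; rewrite mulr0 add0r; apply: dA.
Qed.
HB.instance Definition _ (X : topologicalType) (A : set X) n :=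
  GRing.isSubmodClosed.Build R (chain X n) (chains_in A n)
    (chains_in_closed A n).

Definition relcycle (X : topologicalType) (A : set X * set X) n :
    {pred chain X n} :=
  fun c => (c \in chains_in A.1 n) && (boundary X n c \in chains_in A.2 n.-1).
Arguments relcycle {X} A n.

Lemma relcycle_closed (X : topologicalType) (A : set X * set X) n :
  submod_closed (relcycle A n).
Proof.
split=> [|a c d /andP[c1 c2] /andP[d1 d2]]; apply/andP.
  by split; [exact: rpred0|rewrite linear0; exact: rpred0].
by rewrite linearP; split; rewrite rpredD ?rpredZ.
Qed.
HB.instance Definition _ (X : topologicalType) (A : set X * set X) n :=
  GRing.isSubmodClosed.Build R (chain X n) (relcycle A n) (relcycle_closed A n).

Definition relboundary (X : topologicalType) (A : set X * set X) n :
    {pred chain X n} :=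
  fun c => `[< exists2 d, d \in chains_in A.1 n.+1
                        & c - boundary X n.+1 d \in chains_in A.2 n >].
Arguments relboundary {X} A n.

Lemma relboundaryP (X : topologicalType) (A : set X * set X) n (c : chain X n) :
  reflect (exists2 d, d \in chains_in A.1 n.+1
                    & c - boundary X n.+1 d \in chains_in A.2 n)
          (c \in relboundary A n).
Proof. exact: asboolP. Qed.

Lemma relboundary_closed (X : topologicalType) (A : set X * set X) n :
  submod_closed (relboundary A n).
Proof.
split=> [|a c d /relboundaryP[c' c'1 c'2] /relboundaryP[d' d'1 d'2]].
  apply/relboundaryP; exists 0; first exact: rpred0.
  by rewrite linear0 subr0; exact: rpred0.
apply/relboundaryP; exists (a *: c' + d'); first by rewrite rpredD ?rpredZ.
by rewrite linearP opprD addrACA -scalerBr rpredD ?rpredZ.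
Qed.
HB.instance Definition _ (X : topologicalType) (A : set X * set X) n :=
  GRing.isSubmodClosed.Build R (chain X n) (relboundary A n)
    (relboundary_closed A n).

(* Singular homology of the pair of subspaces (A.1, A.2) of X, where
   A.2 `<=` A.1: relative cycles modulo relative boundaries. A singular simplex
   of a subspace is encoded as a singular simplex of X with image in it. *)
Definition homology (X : topologicalType) (A : set X * set X) (n : nat) :
  lmodType R := subquot (relcycle A n) (relboundary A n).

(* A continuous map of the ambient spaces that restricts to a map of pairs; all
   the maps of pairs needed below (projections, inclusions) are of this form. *)
Record pair_map (X Y : topologicalType) (A : set X * set X) (B : set Y * set Y) :=
  PairMap {
    pair_map_fun :> continuousType X Y;
    pair_map1 : forall x, A.1 x -> B.1 (pair_map_fun x);
    pair_map2 : forall x, A.2 x -> B.2 (pair_map_fun x) }.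

Definition chain_map (X Y : topologicalType) (f : continuousType X Y) n :
    {linear chain X n -> chain Y n} :=
  fglift (fun s : singular_simplex K X n =>
            << (f \o s : singular_simplex K Y n) >>).

Lemma chain_mapU (X Y : topologicalType) (f : continuousType X Y) n
    (s : singular_simplex K X n) :
  chain_map f n << s >> = << (f \o s : singular_simplex K Y n) >>.
Proof. by rewrite /chain_map /= liftU scale1r. Qed.

Lemma chain_map_boundary (X Y : topologicalType) (f : continuousType X Y) n
    (c : chain X n) :
  boundary Y n (chain_map f n c) = chain_map f n.-1 (boundary X n c).
Proof.
case: n c => [|n] c; first by rewrite /= linear0.
apply: (@freeg_linear_ext R _ _ (boundary Y n.+1 \o chain_map f n.+1)
  (chain_map f n \o boundary X n.+1)) => s /=.
rewrite chain_mapU /= !liftU !scale1r linear_sum; apply: eq_bigr => i _.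
rewrite linearZ chain_mapU; congr (_ *: << _ >>).
exact/continuousEP.
Qed.

Lemma chain_map_in (X Y : topologicalType) (f : continuousType X Y)
    (A : set X) (B : set Y) (fAB : forall x, A x -> B (f x)) n (c : chain X n) :
  c \in chains_in A n -> chain_map f n c \in chains_in B n.
Proof.
move=> /chains_inP cA; rewrite -[c]freeg_sumE linear_sum big_seq rpred_sum //.
move=> s; rewrite mem_dom => /cA sA.
have -> : << coeff s c *g s >> = coeff s c *: << s >> :> chain X n.
  by apply/eqP/freeg_eqP => t; rewrite coeffZ !coeffU mul1r.
rewrite linearZ rpredZ // chain_mapU; apply/chains_inP => t.
rewrite coeffU mul1r.
have [<- _ _ [x _ <-]|_] := eqVneq (f \o s : singular_simplex K Y n) t;
  last by rewrite eqxx.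
by apply/fAB/sA; exists x.
Qed.

Section HomologyMap.
Variables (X Y : topologicalType) (A : set X * set X) (B : set Y * set Y).
Variable f : pair_map A B.

Lemma chain_map_cycle n c :
  c \in relcycle A n -> chain_map f n c \in relcycle B n.
Proof.
move=> /andP[c1 c2]; apply/andP; rewrite chain_map_boundary.
by split; [apply: chain_map_in c1|apply: chain_map_in c2];
  [exact: pair_map1|exact: pair_map2].
Qed.

Lemma chain_map_relboundary n c :
  c \in relboundary A n -> chain_map f n c \in relboundary B n.
Proof.
move=> /relboundaryP[d d1 d2]; apply/relboundaryP; exists (chain_map f n.+1 d).
  by apply: chain_map_in d1; exact: pair_map1.
rewrite chain_map_boundary -linearB.
by apply: chain_map_in d2; exact: pair_map2.
Qed.

Definition homology_map n : {linear homology A n -> homology B n} :=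
  subquot_map (@chain_map_cycle n) (@chain_map_relboundary n).

End HomologyMap.

Definition point_map (X : topologicalType) (A : set X) (x : X) :
    pair_map (A, set0) ([set x], set0) :=
  @PairMap X X (A, set0) ([set x], set0) (cst x)
    (fun _ _ => erefl) (fun _ => id).

(* Having the homology of a point means that the map to a point induces
   isomorphisms in homology; over a commutative ring this amounts to the mere
   existence of isomorphisms, over a general ring it need not. *)
Definition acyclic (X : topologicalType) (A : set X) :=
  exists2 x, A x & forall n, bijective (homology_map (point_map A x) n).

End Homology.
Arguments chains_in {K R X} A n.
Arguments relcycle {K R X} A n.
Arguments relboundary {K R X} A n.

Record category := Category {
  ob :> Type;
  hom : ob -> ob -> Type;
  idm : forall A, hom A A;
  compm : forall A B C, hom B C -> hom A B -> hom A C;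
  comp1m : forall A B (f : hom A B), compm (idm B) f = f;
  compm1 : forall A B (f : hom A B), compm f (idm A) = f;
  compA : forall A B C D (h : hom C D) (g : hom B C) (f : hom A B),
    compm h (compm g f) = compm (compm h g) f }.
Arguments hom {c}.
Arguments idm {c}.
Arguments compm {c A B C}.

Definition is_iso (E : category) (A B : E) (f : hom A B) :=
  exists g : hom B A, compm g f = idm A /\ compm f g = idm B.

Definition isomorphic (E : category) (A B : E) :=
  exists f : hom A B, is_iso f.

Record functor (E E' : category) := Functor {
  fob :> E -> E';
  fmap : forall A B, hom A B -> hom (fob A) (fob B);
  fmap1 : forall A, fmap (idm A) = idm (fob A);
  fmap_comp : forall A B C (g : hom B C) (f : hom A B),
    fmap (compm g f) = compm (fmap g) (fmap f) }.

Section Endo.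
Variable E : category.

Definition endo_ob := {A : E & hom A A}.
Definition endo_hom (A B : endo_ob) :=
  {f : hom (projT1 A) (projT1 B) | compm f (projT2 A) = compm (projT2 B) f}.

Lemma endo_homP (A B : endo_ob) (f g : endo_hom A B) :
  proj1_sig f = proj1_sig g -> f = g.
Proof. by case: f g => [f ?] [g ?] /= fg; exact: eq_exist. Qed.

Definition endo_id (A : endo_ob) : endo_hom A A :=
  exist _ (idm (projT1 A)) (etrans (comp1m _) (esym (compm1 _))).

Lemma endo_comp_proof (A B C : endo_ob) (g : endo_hom B C) (f : endo_hom A B) :
  compm (compm (proj1_sig g) (proj1_sig f)) (projT2 A) =
  compm (projT2 C) (compm (proj1_sig g) (proj1_sig f)).
Proof.
by rewrite -compA (proj2_sig f) compA (proj2_sig g) compA.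
Qed.

Definition endo_comp (A B C : endo_ob) (g : endo_hom B C) (f : endo_hom A B) :
    endo_hom A C :=
  exist _ (compm (proj1_sig g) (proj1_sig f)) (endo_comp_proof g f).

Definition Endo : category.
Proof.
apply: (@Category endo_ob endo_hom endo_id endo_comp) => *; apply: endo_homP.
- exact: comp1m.
- exact: compm1.
- exact: compA.
Defined.

(* The morphism a : (A, a) -> (A, a). *)
Definition endo_self (A : Endo) : hom A A :=
  exist _ (projT2 A) erefl : endo_hom A A.

Definition Auto : category :=
  @Category {A : Endo | is_iso (projT2 A)}
    (fun A B => hom (proj1_sig A) (proj1_sig B)) (fun A => idm (proj1_sig A))
    (fun A B C => @compm Endo (proj1_sig A) (proj1_sig B) (proj1_sig C))
    (fun A B => @comp1m Endo (proj1_sig A) (proj1_sig B))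
    (fun A B => @compm1 Endo (proj1_sig A) (proj1_sig B))
    (fun A B C D => @compA Endo (proj1_sig A) (proj1_sig B) (proj1_sig C)
                     (proj1_sig D)).

Definition normal_functor (C : category) (L : functor Endo C) :=
  forall A : Endo, is_iso (fmap L (endo_self A)).

End Endo.

Section GradedModules.
Variable R : nzRingType.

Lemma linear_ext (U V : lmodType R) (f g : {linear U -> V}) : f =1 g -> f = g.
Proof.
case: f g => f [[fz] [fs]] [g [[gz] [gs]]] /= /funext fg.
by subst g; rewrite (Prop_irrelevance fz gz) (Prop_irrelevance fs gs).
Qed.

(* Graded modules, with degrees in nat, and homomorphisms of degree 0. *)
Definition Mod : category.
Proof.
apply: (@Category (nat -> lmodType R)
  (fun A B => forall n, {linear A n -> B n}) (fun A n => idfun)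
  (fun A B C g f n => g n \o f n)) => *;
by apply: functional_extensionality_dep => n; apply: linear_ext.
Defined.

Definition Mod0 : Mod := fun _ => 'rV[R]_0.
Definition Endo0 : Endo Mod := existT (fun A : Mod => hom A A) Mod0 (idm Mod0).
Definition Auto0 : Auto Mod :=
  exist (fun A : Endo Mod => is_iso (projT2 A)) Endo0
    (ex_intro _ (idm Mod0) (conj (comp1m _) (compm1 _))).

End GradedModules.

Section Multivalued.
Variables (X Y : topologicalType) (F : X -> set Y).

(* The multivalued map F assigns to x the subset F x. *)
Definition mv_image (A : set X) : set Y := \bigcup_(a in A) F a.

Definition lower_semicontinuous :=
  forall H : set Y, closed H -> closed [set x | F x `<=` H].

Definition mv_graph (A : set X) : set (X * Y) :=
  [set xy | A xy.1 /\ F xy.1 xy.2].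

Definition mv_graph_pair (A : set X * set X) := (mv_graph A.1, mv_graph A.2).

Definition mv_pair (A : set X * set X) (B : set Y * set Y) :=
  mv_image A.1 `<=` B.1 /\ mv_image A.2 `<=` B.2.

Lemma fst_continuous : continuous (@fst X Y).
Proof. by move=> x; exact: cvg_fst. Qed.
Lemma snd_continuous : continuous (@snd X Y).
Proof. by move=> x; exact: cvg_snd. Qed.

Variables (A : set X * set X) (B : set Y * set Y).

Definition mv_proj1 : pair_map (mv_graph_pair A) A :=
  @PairMap _ _ (mv_graph_pair A) A (mkcts fst_continuous)
    (fun _ => @proj1 _ _) (fun _ => @proj1 _ _).

Definition mv_proj2 (FAB : mv_pair A B) : pair_map (mv_graph_pair A) B :=
  @PairMap _ _ (mv_graph_pair A) B (mkcts snd_continuous)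
    (fun _ xyF => FAB.1 _ (ex_intro2 _ _ _ xyF.1 xyF.2))
    (fun _ xyF => FAB.2 _ (ex_intro2 _ _ _ xyF.1 xyF.2)).

Variables (K : realType) (R : nzRingType).

(* F_* = (p_2)_* o (p_1)_*^-1 *)
Definition mv_homology_map (FAB : mv_pair A B) n :
    {linear homology K R A n -> homology K R B n} :=
  homology_map K R (mv_proj2 FAB) n \o linv (homology_map K R mv_proj1 n).

End Multivalued.

Section Index.
Variables (X : topologicalType) (F : X -> set X).

Definition full_solution (A : set X) (s : int -> X) :=
  forall i, A (s i) /\ F (s i) (s (i + 1)).

Definition invariant_set (A : set X) : set X :=
  [set x | exists2 s, full_solution A s & range s x].

Variable P : set X * set X.

Definition exit_closure := closure (mv_image F P.1 `\` P.1).

Definition bar_pair := (P.1 `|` exit_closure, P.2 `|` exit_closure).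

Hypothesis P21 : P.2 `<=` P.1.
Hypothesis P_exit : P.1 `&` (exit_closure `|` mv_image F P.2) `<=` P.2.

Lemma mv_pair_bar : mv_pair F P bar_pair.
Proof.
have out y : mv_image F P.1 y -> ~ P.1 y -> exit_closure y.
  by move=> Fy Py; apply: subset_closure.
split=> y Fy.
  by have [Py|/(out y Fy) Ey] := pselect (P.1 y); [left|right].
have [Py|Py] := pselect (P.1 y); first by left; apply: P_exit; split=> //; right.
by right; apply: out => //; case: Fy => x Px Fxy; exists x => //; exact: P21.
Qed.

Definition bar_incl : pair_map P bar_pair :=
  @PairMap _ _ P bar_pair idfun
    (fun _ => @or_introl _ _) (fun _ => @or_introl _ _).

(* I_P = (iota_P)_*^-1 o (F_P)_* *)
Definition index_map (K : realType) (R : nzRingType) :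
    hom (homology K R P : Mod R) (homology K R P : Mod R) :=
  fun n => linv (homology_map K R bar_incl n)
             \o mv_homology_map K R mv_pair_bar n.

(* The object (H_*(P), I_P). *)
Definition index_endo (K : realType) (R : nzRingType) : Endo (Mod R) :=
  existT (fun A : Mod R => hom A A) (homology K R P : Mod R) (index_map K R).

End Index.
Arguments index_endo {X F P} P21 P_exit K R.
Arguments Endo0 R : clear implicits.
Arguments Auto0 R : clear implicits.

(* Main.v *)
(* If Inv(P1 \ P2) is empty, then the closed sets Q_0 = P2 and
   Q_(k+1) = {x in P1 | F x <= Q_k `|` E}, with E = cl(F(P1) \ P1), exhaust P1:
   a point of P1 outside all of them has a successor outside all of them, and by
   finiteness this yields a periodic, hence full, solution in P1 \ P2. The index
   map sends the image of H(Q_(k+1), P2) in H(P1, P2) into the image of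
   H(Q_k, P2), so it is nilpotent, with an exponent independent of the degree. A
   normal functor inverts the powers of a nilpotent endomorphism, one of which
   factors through 0, hence its value is isomorphic to L(0) = 0.

   The statement on images amounts to the surjectivity of p_1 over (Q_(k+1), P2)
   and of the excision map for (Q_k, P2). Both become elementary once singular
   chains of a finite space are replaced by chains of its order complex (McCord):
   a chain of the preorder lies in a closed set as soon as its maximum does, so
   excision is a splitting of chains and p_1 is inverted by acyclic carriers.
   McCord's theorem is proved by Mayer-Vietoris for open covers, i.e. by
   barycentric subdivision, with minimal open sets contracted by coning. *)
Require Import Defs.
From HB Require Import structures.
From mathcomp Require Import all_boot all_order all_algebra generic_quotient.
From mathcomp Require Import ring_quotient.
From mathcomp Require Import all_classical all_reals topology normedtype.
From mathcomp Require Import sequences.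
From mathcomp Require Import freeg.
Import Defs.

Set Implicit Arguments.
Unset Strict Implicit.
Unset Printing Implicit Defensive.

Import Order.TTheory GRing.Theory Num.Theory.
Import numFieldNormedType.Exports.
Import Quotient.

Local Open Scope classical_set_scope.
Local Open Scope ring_scope.
Local Open Scope quotient_scope.


(** * Free modules and chains of sequences *)

(** Excision is needed for closed sets, whereas subdivision of singular chains yields it only for
    covers by open sets. This mismatch is why everything passes through the order complex, where
    both kinds of splitting are available. The comparison is stated as acyclicity of a mapping cone
    and not as an isomorphism: one statement then gives injectivity and surjectivity together, and
    Mayer-Vietoris becomes a single argument on chains instead of exact sequences and the five
    lemma. Chains of sequences are augmented by the empty sequence, so that cones, carriers and
    subdivision obey one boundary formula in every degree and acyclicity of a set includes its
    non-emptiness. The lifts along [p_1] respect all closed sets at once, so a representative can be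
    followed through the index map without naturality squares in homology. *)

Section Supported.
Variables (R : nzRingType) (S : choiceType).
Implicit Types (P Q : set S) (c : {freeg S / R}).

(** The common shape of the submodules of chains used below: [chains_in], [small] and the chains of
    a nerve are all of this form, the first by conversion. *)
Definition supported P : {pred {freeg S / R}} :=
  fun c => `[< forall s, coeff s c != 0 -> P s >].

Lemma supportedP P c :
  reflect (forall s, coeff s c != 0 -> P s) (c \in supported P).
Proof. exact: asboolP. Qed.

Lemma supported_closed P : submod_closed (supported P).
Proof.
split=> [|a c d /supportedP cP /supportedP dP].
  by apply/supportedP => s; rewrite coeff0 eqxx.
apply/supportedP => s; rewrite coeffD coeffZ.
have [/eqP|c0 _] := boolP (coeff s c == 0); last exact: cP.
by move=> ->; rewrite mulr0 add0r; apply: dP.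
Qed.
HB.instance Definition _ P :=
  GRing.isSubmodClosed.Build R {freeg S / R} (supported P) (supported_closed P).

Lemma supportedU P s : P s -> << s >> \in supported P.
Proof.
move=> Ps; apply/supportedP => t; rewrite coeffU mul1r.
by have [<-|_] := eqVneq s t; rewrite ?eqxx.
Qed.

Lemma supportedS P Q : P `<=` Q -> {subset supported P <= supported Q}.
Proof. by move=> PQ c /supportedP cP; apply/supportedP => s /cP/PQ. Qed.

Lemma supportedI P Q c :
  c \in supported P -> c \in supported Q -> c \in supported (P `&` Q).
Proof.
by move=> /supportedP cP /supportedP cQ; apply/supportedP => s s0; split; auto.
Qed.

Lemma freeg_basisE c : c = \sum_(s <- dom c) coeff s c *: << s >>.
Proof.
rewrite -{1}[c]freeg_sumE; apply: eq_bigr => s _.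
by apply/eqP/freeg_eqP => t; rewrite coeffZ !coeffU mul1r.
Qed.

Section Linear.
Variables (M : lmodType R).

Lemma supported_ind P (Q : M -> Prop) (f : {linear {freeg S / R} -> M}) :
  Q 0 -> (forall a u v, Q u -> Q v -> Q (a *: u + v)) ->
  (forall s, P s -> Q (f << s >>)) -> forall c, c \in supported P -> Q (f c).
Proof.
move=> Q0 QD Qf c /supportedP cP; rewrite [c]freeg_basisE linear_sum.
have: {subset dom c <= [pred s | `[< P s >]]}.
  by move=> s; rewrite mem_dom => /cP Ps; apply/asboolP.
elim: (dom c) => [_|s r IH sub]; first by rewrite big_nil.
rewrite big_cons linearZ; apply: QD.
  by apply/Qf/asboolP/sub; rewrite mem_head.
by apply: IH => t tr; apply: sub; rewrite in_cons tr orbT.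
Qed.

Lemma supported_map P (Q : submodClosed M) (f : {linear {freeg S / R} -> M}) :
  (forall s, P s -> f << s >> \in Q) ->
  forall c, c \in supported P -> f c \in Q.
Proof.
move=> fQ; apply: (supported_ind (Q := fun v => v \in Q)) fQ.
  exact: rpred0.
by move=> a u v uQ vQ; rewrite rpredD ?rpredZ.
Qed.

Lemma supported_ext P (f g : {linear {freeg S / R} -> M}) :
  (forall s, P s -> f << s >> = g << s >>) ->
  forall c, c \in supported P -> f c = g c.
Proof.
move=> fg c cP; apply/eqP; rewrite -subr_eq0; apply/eqP.
apply: (@supported_ind P (fun v => v = 0) (f \- g)) cP => //= [a u v -> ->|s Ps].
  by rewrite scaler0 addr0.
by rewrite fg ?subrr.
Qed.

End Linear.

(** Serves both Mayer-Vietoris and excision; basis elements in both sets may go to either side. *)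
Lemma supported_split P Q c : c \in supported (P `|` Q) ->
  exists2 c1, c1 \in supported P & c - c1 \in supported Q.
Proof.
apply: (@supported_ind _ (P `|` Q) (fun c => exists2 c1, c1 \in supported P &
  c - c1 \in supported Q) idfun) => [|a u v [u1 uP uQ] [v1 vP vQ]|s [Ps|Qs]].
- by exists 0; rewrite ?subrr rpred0.
- exists (a *: u1 + v1); first by rewrite rpredD ?rpredZ.
  by rewrite opprD addrACA -scalerBr rpredD ?rpredZ.
- by exists << s >>; [exact: supportedU|rewrite subrr rpred0].
- by exists 0; [exact: rpred0|rewrite subr0; exact: supportedU].
Qed.

End Supported.
Arguments supported R {S} P.

Lemma fgliftU (R : nzRingType) (S : choiceType) (M : lmodType R) (f : S -> M) s :
  fglift f << s >> = f s.
Proof. by rewrite liftU scale1r. Qed.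

(* Chains on finite sequences form an augmented complex: sequences of size
   n.+1 span degree n and the empty sequence spans degree -1. The boundary is
   determined by the cone formula [d_cone]. *)
Section SequenceChains.
Variables (R : nzRingType) (T : choiceType).

Definition lchain := {freeg (seq T) / R}.

Definition cone (x : T) : {linear lchain -> lchain} :=
  fglift (fun s : seq T => << x :: s >> : lchain).

Lemma coneU x s : cone x << s >> = << x :: s >>.
Proof. exact: fgliftU. Qed.

Fixpoint dseq (s : seq T) : lchain :=
  if s is x :: s' then << s' >> - cone x (dseq s') else 0.

Definition dl : {linear lchain -> lchain} := fglift dseq.

Lemma dlU s : dl << s >> = dseq s.
Proof. exact: fgliftU. Qed.

Lemma dseq_nil : dseq [::] = 0.
Proof. by []. Qed.

Lemma dseq_cons x s : dseq (x :: s) = << s >> - cone x (dseq s).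
Proof. by []. Qed.

Lemma dl_cone x c : dl (cone x c) = c - cone x (dl c).
Proof.
apply: (freeg_linear_ext (f := dl \o cone x) (g := idfun \- (cone x \o dl))).
by move=> s /=; rewrite coneU !dlU.
Qed.

Lemma dl_dseq s : dl (dseq s) = 0.
Proof.
elim: s => [|x s IH] /=; first exact: linear0.
by rewrite linearB /= dl_cone dlU IH linear0 subr0 subrr.
Qed.

Lemma dl_dl c : dl (dl c) = 0.
Proof.
apply: (freeg_linear_ext (f := dl \o dl) (g := \0)) => s /=.
by rewrite dlU dl_dseq.
Qed.

Definition face_of (s : seq T) : set (seq T) :=
  [set t | subseq t s /\ size s = (size t).+1].

Lemma dseq_face s : dseq s \in supported R (face_of s).
Proof.
elim: s => [|x s IH] /=; first exact: rpred0.
apply: rpredB; first by apply: supportedU; split; [exact: subseq_cons|].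
apply: (supported_map (P := face_of s)) IH => t [ts st].
by rewrite coneU; apply: supportedU; rewrite /face_of /= eqxx ts st.
Qed.

Definition del (i : nat) (s : seq T) := take i s ++ drop i.+1 s.

Lemma dseqE s : dseq s = \sum_(i < size s) (-1) ^+ i *: << del i s >>.
Proof.
elim: s => [|x s IH] /=; first by rewrite big_ord0.
rewrite big_ord_recl expr0 scale1r /del /= drop0; congr (_ + _).
rewrite IH linear_sum -sumrN; apply: eq_bigr => i _ /=.
by rewrite linearZ coneU -scaleNr exprS mulN1r /bump /= add1n.
Qed.

Section Recursion.
Variables (M : lmodType R) (base : M) (step : seq T -> M -> M).

(** Recursion on a simplex through the value on its boundary. The boundary is a formal sum and not a
    structurally smaller sequence, hence the fuel. *)
Fixpoint lrec_fuel (n : nat) (s : seq T) : M :=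
  if n is n'.+1 then step s (fglift (lrec_fuel n') (dseq s)) else base.

Definition lrec : {linear lchain -> M} :=
  fglift (fun s => lrec_fuel (size s) s).

Lemma lrec_nil : lrec << [::] >> = base.
Proof. exact: fgliftU. Qed.

Lemma lrec_cons x s :
  lrec << x :: s >> = step (x :: s) (lrec (dseq (x :: s))).
Proof.
transitivity (lrec_fuel (size (x :: s)) (x :: s)); first exact: fgliftU.
rewrite /=; congr (step _ _).
(* All faces of [x :: s] have size [size s], so one amount of fuel suits every term. *)
apply: (supported_ext (f := fglift (lrec_fuel (size s))) (g := lrec))
  (dseq_face (x :: s)).
by move=> t [_ [st]] /=; rewrite !fgliftU -st.
Qed.

End Recursion.

End SequenceChains.
Arguments dseq R {T} s : simpl never.
Arguments dl R {T}.
Arguments cone R {T} x.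
Arguments lrec {R T M} base step.
Opaque dl cone lrec.

Section SequenceChainMap.
Variables (R : nzRingType) (T U : choiceType) (f : T -> U).

Definition lmap : {linear lchain R T -> lchain R U} :=
  fglift (fun s => << map f s >> : lchain R U).

Lemma lmapU s : lmap << s >> = << map f s >>.
Proof. exact: fgliftU. Qed.

Lemma lmap_cone x c : lmap (cone R x c) = cone R (f x) (lmap c).
Proof.
apply: (freeg_linear_ext (f := lmap \o cone R x) (g := cone R (f x) \o lmap)).
by move=> s /=; rewrite coneU !lmapU coneU.
Qed.

Lemma lmap_dseq s : lmap (dseq R s) = dseq R (map f s).
Proof.
elim: s => [|x s IH]; first exact: linear0.
by rewrite [dseq R _]dseq_cons linearB /= lmapU lmap_cone IH.
Qed.

Lemma lmap_dl c : dl R (lmap c) = lmap (dl R c).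
Proof.
apply: (freeg_linear_ext (f := dl R \o lmap) (g := lmap \o dl R)) => s /=.
by rewrite lmapU !dlU lmap_dseq.
Qed.

End SequenceChainMap.
Arguments lmap R {T U} f.
Opaque lmap.

(** * Affine simplices *)

Section SimplexGeometry.
Variable K : realType.
Local Notation simplex n := (set_type (std_simplex K n)).

Definition to_simplex n (t : 'rV[K]_n.+1) (h : std_simplex K n t) : simplex n :=
  SigSub (mem_set h).

Lemma simplex_ge0 n (t : simplex n) i : 0 <= (val t) 0 i.
Proof. by have [] := set_valP t. Qed.

Lemma simplex_sum n (t : simplex n) : \sum_i (val t) 0 i = 1.
Proof. by have [] := set_valP t. Qed.

Lemma simplex_le1 n (t : simplex n) i : (val t) 0 i <= 1.
Proof.
rewrite -(simplex_sum t) (bigD1 i) //= lerDl sumr_ge0 // => j _.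
exact: simplex_ge0.
Qed.

Lemma sum_continuous (Z : topologicalType) (I : Type) (r : seq I)
    (g : I -> Z -> K) (z : Z) : (forall i, {for z, continuous (g i)}) ->
  {for z, continuous (fun x => \sum_(i <- r) g i x)}.
Proof.
move=> gc; elim: r => [|i r IH].
  have -> : (fun x => \sum_(i <- [::]) g i x) = cst 0.
    by apply/funext => x; rewrite big_nil.
  exact: cvg_cst.
have -> : (fun x => \sum_(j <- i :: r) g j x) =
    (fun x => g i x + \sum_(j <- r) g j x).
  by apply/funext => x; rewrite big_cons.
by apply: cvgD; [exact: gc|exact: IH].
Qed.

Lemma row_continuous (Z : topologicalType) n (g : Z -> 'rV[K]_n) (z : Z) :
  (forall j, {for z, continuous (fun x => g x 0 j)}) -> {for z, continuous g}.
Proof.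
move=> gc A [P Pz PA]; apply: (@filterS _ _ _
  (fun x => forall j, P 0 j (g x 0 j))) => [x Px|].
  by apply: PA => i j; rewrite (ord1 i); exact: Px.
by apply: filter_forall => j; apply: gc; exact: Pz.
Qed.

Lemma mulmx_continuous m n (M : 'M[K]_(m, n)) :
  continuous (fun t : 'rV[K]_m => t *m M).
Proof.
move=> t; apply: row_continuous => j.
have -> : (fun x : 'rV[K]_m => (x *m M) 0 j) =
    (fun x : 'rV_m => \sum_i x 0 i * M i j).
  by apply/funext => x; rewrite mxE.
apply: sum_continuous => i.
exact: (cvgM (@coord_continuous K 1 m 0 i t) (@cvg_cst _ (M i j) _ (nbhs t) _)).
Qed.

Lemma std_simplex_compact n : compact (std_simplex K n).
Proof.
apply: (@subclosed_compact _ _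
  [set t : 'rV[K]_n.+1 | forall i, `[0, 1]%classic (t ord0 i)]).
- have -> : std_simplex K n =
      \bigcap_i [set t : 'rV[K]_n.+1 | 0 <= t 0 i] `&`
      [set t : 'rV[K]_n.+1 | \sum_i t 0 i = 1].
    apply/seteqP; split=> t /= [t0 t1]; split=> // i; last exact: (t0 i I).
    by move=> _; exact: t0.
  apply: closedI.
    apply: closed_bigI => i _.
    apply: (@preimage_closed 'rV[K]_n.+1 K (fun t => t 0 i) [set x | 0 <= x]).
      by move=> t _; exact: coord_continuous.
    exact: closed_ge.
  apply: (@preimage_closed 'rV[K]_n.+1 K (fun t => \sum_i t 0 i) [set x | x = 1]).
    by move=> t _; apply: sum_continuous => i; exact: coord_continuous.
  exact: closed_eq.
- exact: (@rV_compact K n.+1 (fun _ => `[0, 1]%classic)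
    (fun _ => @segment_compact K 0 1)).
move=> t tS i; have t0 := simplex_ge0 (to_simplex tS) i.
by have t1 := simplex_le1 (to_simplex tS) i; rewrite /= in_itv /=; apply/andP.
Qed.

Definition vertex_mx n k (s : k.-tuple (simplex n)) : 'M[K]_(k, n.+1) :=
  \matrix_i val (tnth s i).

Lemma affine_simplex n k (s : k.+1.-tuple (simplex n)) (t : simplex k) :
  std_simplex K n (val t *m vertex_mx s).
Proof.
split=> [j|].
  rewrite mxE sumr_ge0 // => i _.
  by rewrite mulr_ge0 ?simplex_ge0 // mxE simplex_ge0.
under eq_bigr do rewrite mxE.
rewrite exchange_big /= -[RHS](simplex_sum t); apply: eq_bigr => i _.
rewrite -mulr_sumr (eq_bigr (fun j => (val (tnth s i)) 0 j)) => [|j _].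
  by rewrite simplex_sum mulr1.
by rewrite mxE.
Qed.

Definition affine_fun n k (s : k.+1.-tuple (simplex n)) (t : simplex k) :
  simplex n := to_simplex (affine_simplex s t).

Lemma affine_fun_continuous n k (s : k.+1.-tuple (simplex n)) :
  continuous (affine_fun s).
Proof.
apply: continuous_comp_initial => t.
apply: (@continuous_comp _ _ _ (@set_val _ (std_simplex K k))
  (fun t => t *m vertex_mx s)).
  exact: initial_continuous.
exact: mulmx_continuous.
Qed.

Definition affine n k (s : k.+1.-tuple (simplex n)) :
    continuousType (std_simplex K k) (std_simplex K n) :=
  mkcts (@affine_fun_continuous n k s).

Lemma affineE n k (s : k.+1.-tuple (simplex n)) t :
  val (affine s t) = \sum_i (val t) 0 i *: val (tnth s i).
Proof.
rewrite /= mulmx_sum_row; apply: eq_bigr => i _; congr (_ *: _).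
by apply/rowP => j; rewrite !mxE.
Qed.

Lemma basis_simplex n (i : 'I_n.+1) : std_simplex K n (delta_mx 0 i).
Proof.
split=> [j|]; first by rewrite mxE eqxx ler0n.
rewrite (bigD1 i) //= big1 => [|j /negPf ji]; first by rewrite mxE !eqxx addr0.
by rewrite mxE eqxx ji.
Qed.

Definition basis n (i : 'I_n.+1) : simplex n := to_simplex (basis_simplex i).

Definition basis_tuple n := [tuple basis i | i < n.+1].

Lemma affine_basis n (t : simplex n) : affine (basis_tuple n) t = t.
Proof.
apply/val_inj; rewrite affineE [RHS]row_sum_delta; apply: eq_bigr => i _.
by rewrite tnth_mktuple.
Qed.

(** Maps induced by matrices commute with affine combinations; faces and affine simplices are of
    this kind, and barycentric subdivision is natural for them. *)
Definition linear_map m n (g : simplex m -> simplex n) :=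
  exists M : 'M[K]_(m.+1, n.+1), forall t, val (g t) = val t *m M.

Lemma affine_linear n k (s : k.+1.-tuple (simplex n)) : linear_map (affine s).
Proof. by exists (vertex_mx s). Qed.

Lemma affine_map m n k (g : simplex m -> simplex n)
    (s : k.+1.-tuple (simplex m)) (t : simplex k) :
  linear_map g -> affine (map_tuple g s) t = g (affine s t).
Proof.
move=> [M gM]; apply/val_inj; rewrite gM !affineE mulmx_suml.
by apply: eq_bigr => i _; rewrite tnth_map gM scalemxAl.
Qed.

Definition del_tuple (T : Type) n (i : 'I_n.+2) (s : n.+2.-tuple T) :
  n.+1.-tuple T := [tuple tnth s (fintype.lift i j) | j < n.+1].

Lemma val_del_tuple (T : choiceType) n (i : 'I_n.+2) (s : n.+2.-tuple T) :
  val (del_tuple i s) = del i s.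
Proof.
apply: (@eq_from_nth _ (tnth s ord0)) => [|j]; rewrite size_tuple.
  rewrite size_cat size_take size_drop size_tuple ltn_ord.
  by rewrite subSS subnKC // -ltnS.
move=> jn; rewrite -[j]/(val (Ordinal jn)) -tnth_nth tnth_mktuple.
rewrite (tnth_nth (tnth s ord0)) nth_cat size_take size_tuple ltn_ord /= /bump.
case: ltnP => ij; first by rewrite nth_take // leqNgt ij.
by rewrite nth_drop addSn subnKC.
Qed.

Lemma affine_face n k (s : k.+2.-tuple (simplex n)) i t :
  affine s (face K i t) = affine (del_tuple i s) t.
Proof.
apply/val_inj; rewrite !affineE (bigD1_ord i) //=.
rewrite mxE unlift_none scale0r add0r; apply: eq_bigr => j _.
by rewrite mxE liftK tnth_mktuple.
Qed.

Lemma face_basis n (i : 'I_n.+2) :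
  map_tuple (face K i) (basis_tuple n) = del_tuple i (basis_tuple n.+1).
Proof.
apply: eq_from_tnth => j; rewrite tnth_map !tnth_mktuple.
apply/val_inj/rowP => k; rewrite /= !mxE.
case: unliftP => [l ->|->] /=; last by rewrite (negPf (neq_lift i j)).
by rewrite mxE (inj_eq lift_inj).
Qed.

Lemma face_linear n (i : 'I_n.+2) : linear_map (face K i).
Proof.
exists (vertex_mx (map_tuple (face K i) (basis_tuple n))) => t.
transitivity (val (affine (map_tuple (face K i) (basis_tuple n)) t)) => //.
by rewrite face_basis -affine_face affine_basis.
Qed.

End SimplexGeometry.

(** * Barycentric subdivision *)

Lemma tuple_of (T : Type) n (s : seq T) :
  size s = n -> exists t : n.-tuple T, s = t.
Proof. by move=> /eqP sn; exists (Tuple sn). Qed.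

Lemma chains_inU (K : realType) (R : nzRingType) (X : topologicalType)
    (A : set X) n (s : singular_simplex K X n) :
  range s `<=` A -> << s >> \in @chains_in K R X A n.
Proof.
move=> sA; apply/chains_inP => t; rewrite coeffU mul1r.
by have [<-|_] := eqVneq s t; rewrite ?eqxx.
Qed.

Lemma boundary0 (K : realType) (R : nzRingType) (X : topologicalType)
    (c : chain K R X 0) : boundary K R X 0 c = 0.
Proof. by []. Qed.

Lemma boundaryU (K : realType) (R : nzRingType) (X : topologicalType) n
    (s : singular_simplex K X n.+1) : boundary K R X n.+1 << s >> =
  \sum_(i < n.+2) (-1) ^+ i *: << (s \o face K i : singular_simplex K X n) >>.
Proof. exact: fgliftU. Qed.

(** * Singular chains from chains of sequences *)

Section Realization.
Variables (K : realType) (R : nzRingType) (T : choiceType) (X : topologicalType).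
Variable f : forall n, n.+1.-tuple T -> singular_simplex K X n.

(** One construction for two uses: affine simplices pushed along a singular simplex, and simplices
    of the order complex. Sequences of the wrong length go to 0, which gives in each degree a linear
    map on the ungraded chains. *)
Definition realize n : {linear lchain R T -> chain K R X n} :=
  fglift (fun s : seq T =>
    oapp (fun t : n.+1.-tuple T => << f t >>) (0 : chain K R X n) (insub s)).

Lemma realizeU n (s : n.+1.-tuple T) : realize n << val s >> = << f s >>.
Proof. by rewrite /realize /= fgliftU valK. Qed.

Lemma realize_size n s : size s != n.+1 -> realize n << s >> = 0.
Proof. by move=> sn; rewrite /realize /= fgliftU insubF //; apply: negbTE. Qed.

Variable P : set (seq T).
Hypothesis f_face : forall n (s : n.+2.-tuple T) i, P s ->
  f s \o face K i =1 f (del_tuple i s).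

Lemma realize_boundary n c : c \in supported R P ->
  boundary K R X n.+1 (realize n.+1 c) = realize n (dl R c).
Proof.
apply: (supported_ext (f := boundary K R X n.+1 \o realize n.+1)
  (g := realize n \o dl R)) => s; have [sn|sn] := eqVneq (size s) n.+2.
  have [t -> Pt /=] := tuple_of sn.
  rewrite realizeU dlU dseqE /= fgliftU linear_sum size_tuple; apply: eq_bigr => i _.
  rewrite linearZ -val_del_tuple realizeU; congr (_ *: << _ >>).
  by apply/continuousEP; exact: f_face.
rewrite /= realize_size // linear0 dlU => _; apply/esym.
apply: (supported_ext (f := realize n) (g := \0)) (dseq_face R s) => t [_ st].
by apply: realize_size; rewrite -eqSS -st.
Qed.

Lemma realize_in n A c : c \in supported R P ->
  (forall s : n.+1.-tuple T, P s -> range (f s) `<=` A) ->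
  realize n c \in chains_in A n.
Proof.
move=> cP fA; apply: (supported_map (P := P)) cP => s.
have [sn|sn] := eqVneq (size s) n.+1; last first.
  by rewrite realize_size // => _; exact: rpred0.
have [t -> Pt] := tuple_of sn; rewrite realizeU.
by apply: chains_inU; exact: fA.
Qed.

End Realization.
Arguments realize {K} R {T X} f n.
Opaque realize.

Lemma realize_map (K : realType) (R : nzRingType) (T U : choiceType)
    (X Y : topologicalType)
    (f : forall n, n.+1.-tuple T -> singular_simplex K X n)
    (g : forall n, n.+1.-tuple U -> singular_simplex K Y n)
    (h : T -> U) n (G : {linear chain K R X n -> chain K R Y n})
    (P : set (seq T)) :
  (forall s : n.+1.-tuple T, P s -> G << f n s >> = << g n (map_tuple h s) >>) ->
  forall c, c \in supported R P ->
  G (realize R f n c) = realize R g n (lmap R h c).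
Proof.
move=> fg; apply: (supported_ext (f := G \o realize R f n)
  (g := realize R g n \o lmap R h)) => s /=; rewrite lmapU.
have [sn|sn] := eqVneq (size s) n.+1; last first.
  by rewrite !realize_size ?size_map // linear0.
have [t -> Pt] := tuple_of sn; rewrite realizeU fg //.
by rewrite -[map h t]/(val (map_tuple h t)) realizeU.
Qed.

Section Subdivision.
Variables (K : realType) (R : nzRingType).
Local Notation simplex n := (set_type (std_simplex K n)).

Lemma barycenter_simplex n (v : simplex n) s :
  std_simplex K n ((size s).+1%:R^-1 *: \sum_(w <- v :: s) val w).
Proof.
split=> [j|].
  rewrite mxE mulr_ge0 ?invr_ge0 ?ler0n // summxE sumr_ge0 // => w _.
  exact: simplex_ge0.
under eq_bigr do rewrite mxE summxE.
rewrite -mulr_sumr exchange_big /=.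
rewrite (eq_bigr (fun=> 1)) => [|w _]; last exact: simplex_sum.
by rewrite big_const_seq count_predT iter_addr_0 /= mulVf // pnatr_eq0.
Qed.

Definition barycenter n (s : seq (simplex n)) : simplex n :=
  if s is v :: s' then to_simplex (barycenter_simplex v s') else basis K ord0.

Lemma barycenter_map m n (g : simplex m -> simplex n) v s :
  linear_map g -> barycenter (map g (v :: s)) = g (barycenter (v :: s)).
Proof.
move=> [M gM]; apply/val_inj; rewrite gM /= size_map -scalemxAl mulmx_suml.
congr (_ *: _); rewrite -[g v :: _]/(map g (v :: s)) big_map.
by apply: eq_bigr => w _; rewrite gM.
Qed.

(** The cone from the barycenter over the subdivided boundary; fixing the empty sequence makes [sd]
    compatible with the augmentation. *)
Definition sd n : {linear lchain R (simplex n) -> lchain R (simplex n)} :=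
  lrec << [::] >> (fun s => cone R (barycenter s)).

Opaque sd.

Lemma sd_nil n : sd n << [::] >> = << [::] >>.
Proof. exact: lrec_nil. Qed.

Lemma sd_cons n v s :
  sd n << v :: s >> = cone R (barycenter (v :: s)) (sd n (dseq R (v :: s))).
Proof. exact: lrec_cons. Qed.

(** Matches maps defined by [lrec]: their value on a simplex is determined by the simplex and their
    value on its boundary, so equality propagates by dimension. *)
Lemma lchain_ind (T : choiceType) (M : lmodType R)
    (f g : {linear lchain R T -> M}) :
  f << [::] >> = g << [::] >> ->
  (forall v s, f (dseq R (v :: s)) = g (dseq R (v :: s)) ->
    f << v :: s >> = g << v :: s >>) ->
  f =1 g.
Proof.
move=> fg0 fgS; apply: freeg_linear_ext => s.
have [n] := ubnP (size s); elim: n s => // n IH [|v s] // sn; apply: fgS.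
apply: (supported_ext (f := f) (g := g)) (dseq_face R (v :: s)) => t [_ [st]].
by apply: IH; rewrite -st.
Qed.

Lemma sd_dl n c : dl R (sd n c) = sd n (dl R c).
Proof.
apply: (lchain_ind (f := dl R \o sd n) (g := sd n \o dl R)) => [|v s] /=.
  by rewrite sd_nil dlU dseq_nil linear0.
move=> IH; rewrite sd_cons dl_cone IH.
by rewrite dl_dseq !linear0 addr0 dlU.
Qed.

Lemma sd_map m n (g : simplex m -> simplex n) c : linear_map g ->
  lmap R g (sd m c) = sd n (lmap R g c).
Proof.
move=> glin; apply: (lchain_ind (f := lmap R g \o sd m)
  (g := sd n \o lmap R g)) => [|v s IH]; rewrite [LHS]/= [RHS]/=.
  by rewrite sd_nil lmapU sd_nil.
rewrite sd_cons lmap_cone [lmap R g (sd m _)]IH /= lmapU [map g _]/= sd_cons.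
by rewrite -[g v :: _]/(map g (v :: s)) barycenter_map // lmap_dseq.
Qed.

(** The chain being coned is what the homotopy identity requires as boundary. It is a cycle by
    induction, so the cone fills it. *)
Definition sdh n : {linear lchain R (simplex n) -> lchain R (simplex n)} :=
  lrec 0 (fun s c => cone R (barycenter s) (<< s >> - sd n << s >> - c)).

Opaque sdh.

Lemma sdh_nil n : sdh n << [::] >> = 0.
Proof. exact: lrec_nil. Qed.

Lemma sdh_cons n v s : sdh n << v :: s >> = cone R (barycenter (v :: s))
  (<< v :: s >> - sd n << v :: s >> - sdh n (dseq R (v :: s))).
Proof. exact: lrec_cons. Qed.

Lemma sdh_dl n c : dl R (sdh n c) = c - sd n c - sdh n (dl R c).
Proof.
apply: (lchain_ind (f := dl R \o sdh n)
  (g := (idfun \- sd n) \- (sdh n \o dl R))) => [|v s IH].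
  by rewrite /= sdh_nil sd_nil dlU dseq_nil subrr !linear0 addr0.
have z0 : dl R (<< v :: s >> - sd n << v :: s >> - sdh n (dseq R (v :: s))) = 0.
  rewrite 2!linearB /= [dl R (sdh n _)]IH /= sd_dl dlU dl_dseq linear0 subr0.
  by rewrite subrr.
by rewrite /= sdh_cons dl_cone z0 linear0 subr0 dlU.
Qed.

Lemma sdh_map m n (g : simplex m -> simplex n) c : linear_map g ->
  lmap R g (sdh m c) = sdh n (lmap R g c).
Proof.
move=> glin; apply: (lchain_ind (f := lmap R g \o sdh m)
  (g := sdh n \o lmap R g)) => [|v s IH]; rewrite [LHS]/= [RHS]/=.
  by rewrite sdh_nil lmapU sdh_nil linear0.
rewrite sdh_cons lmap_cone -barycenter_map // lmapU sdh_cons; congr (cone R _ _).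
rewrite !(linearB (lmap R g)) sd_map // lmapU; congr (_ - _).
rewrite -[g v :: _]/(map g (v :: s)) -lmap_dseq.
exact: IH.
Qed.

End Subdivision.

(** * Mesh estimates for barycentric subdivision *)

Section Mesh.
Variables (K : realType) (R : nzRingType).
Local Notation simplex n := (set_type (std_simplex K n)).

Lemma affine_ball n k (s : k.+1.-tuple (simplex n)) (t : simplex k)
    (w : 'rV[K]_n.+1) (r : K) :
  (forall i, `|val (tnth s i) - w| <= r) -> `|val (affine s t) - w| <= r.
Proof.
move=> sr; rewrite affineE -[w in X in X <= _]scale1r -(simplex_sum t).
rewrite scaler_suml -sumrB (le_trans (ler_norm_sum _ _ _)) //.
rewrite -[r]mul1r -(simplex_sum t) mulr_suml ler_sum // => i _.
by rewrite -scalerBr normrZ ger0_norm ?simplex_ge0 // ler_wpM2l ?simplex_ge0.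
Qed.

Lemma barycenter_sub n v s (w : 'rV[K]_n.+1) :
  `|val (barycenter (v :: s)) - w| <=
  (size s).+1%:R^-1 * \sum_(u <- v :: s) `|val u - w|.
Proof.
have -> : val (barycenter (v :: s)) - w =
    (size s).+1%:R^-1 *: \sum_(u <- v :: s) (val u - w).
  rewrite sumrB scalerBr; congr (_ - _).
  rewrite big_const_seq count_predT iter_addr_0 -(scaler_nat _ w) scalerA mulVf.
    by rewrite scale1r.
  by rewrite pnatr_eq0.
rewrite normrZ ger0_norm ?invr_ge0 ?ler0n // ler_wpM2l ?invr_ge0 ?ler0n //.
exact: ler_norm_sum.
Qed.

Lemma barycenter_ball n v s (w : 'rV[K]_n.+1) (r : K) :
  (forall u, u \in v :: s -> `|val u - w| <= r) ->
  `|val (barycenter (v :: s)) - w| <= r.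
Proof.
move=> sr; apply: le_trans (barycenter_sub v s w) _.
rewrite mulrC ler_pdivrMr ?ltr0n // mulr_natr.
have -> : r *+ (size s).+1 = \sum_(u <- v :: s) r.
  by rewrite big_const_seq count_predT iter_addr_0.
by rewrite big_seq [leRHS]big_seq ler_sum.
Qed.

Definition mesh_le n (r : K) (s : seq (simplex n)) :=
  forall u v, u \in s -> v \in s -> `|val u - val v| <= r.

(** The vertex [u] contributes 0 to the average of the distances to [u], which leaves [size s] terms
    out of [(size s).+1]: the classical contraction factor. *)
Lemma barycenter_mesh n v s (r : K) u : mesh_le r (v :: s) -> u \in v :: s ->
  `|val (barycenter (v :: s)) - val u :> 'rV[K]_n.+1| <=
  (size s)%:R / (size s).+1%:R * r.
Proof.
move=> sr us; apply: le_trans (barycenter_sub v s (val u)) _.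
rewrite mulrAC mulrC ler_wpM2r ?invr_ge0 ?ler0n //.
rewrite (perm_big _ (perm_to_rem us)) big_cons subrr normr0 [leLHS]add0r mulr_natl.
have -> : r *+ size s = \sum_(w <- rem u (v :: s)) r.
  by rewrite big_const_seq count_predT iter_addr_0 size_rem.
rewrite big_seq [leRHS]big_seq ler_sum // => w /mem_rem ws.
exact: sr.
Qed.

(** The last clause, that subdivision stays within every ball containing the vertices, drives the
    induction: for balls around the barycenter it bounds the distance from the apex to the vertices
    of the subdivided faces. The ratio is that of a fixed top dimension [N], so that it can be
    iterated. *)
Lemma sd_mesh n N (r : K) s : (size s <= N.+1)%N -> 0 <= r -> mesh_le r s ->
  sd K R n << s >> \in supported R [set t | [/\ size t = size s,
    mesh_le (N%:R / N.+1%:R * r) t &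
    forall (w : 'rV[K]_n.+1) a, (forall u, u \in s -> `|val u - w| <= a) ->
      forall u, u \in t -> `|val u - w| <= a]].
Proof.
move=> sN r0; have [k] := ubnP (size s).
elim: k s sN => // k IH [|v s] sN sk sr.
  by rewrite sd_nil; apply: supportedU; split.
rewrite sd_cons; pose Q := [set t | [/\ size t = size s,
    mesh_le (N%:R / N.+1%:R * r) t &
    forall (w : 'rV[K]_n.+1) a, (forall u, u \in v :: s -> `|val u - w| <= a) ->
      forall u, u \in t -> `|val u - w| <= a]].
have sdQ : sd K R n (dseq R (v :: s)) \in supported R Q.
  apply: supported_map (dseq_face R (v :: s)) => t [ts /= [st]].
  have tsub := mem_subseq ts.
  have tr : mesh_le r t by move=> u u' /tsub us /tsub us'; exact: sr.
  have tN : (size t <= N.+1)%N by rewrite -st ltnW.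
  have tk : (size t < k)%N by rewrite -st.
  apply: supportedS (IH t tN tk tr) => q [qt qr qh]; split=> //.
    by rewrite qt -st.
  by move=> w a sa; apply: qh => u /tsub; exact: sa.
apply: supported_map sdQ => t [ts tr th]; rewrite coneU; apply: supportedU.
set b := barycenter (v :: s).
(* The ratio [k / (k + 1)] increases with [k], and [size s] is at most [N]. *)
have sNr : (size s)%:R / (size s).+1%:R * r <= N%:R / N.+1%:R * r.
  rewrite ler_wpM2r // ler_pdivrMr ?ltr0n // mulrAC ler_pdivlMr ?ltr0n //.
  by rewrite -!natrM ler_nat mulnSr mulnS mulnC addnC leq_add2r -ltnS.
have br u : u \in t -> `|val u - val b| <= N%:R / N.+1%:R * r.
  apply: th => u' us; rewrite distrC; apply: le_trans sNr.
  exact: barycenter_mesh.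
split; first by rewrite /= ts.
  move=> u u'; rewrite !inE => /predU1P[->|ut] /predU1P[->|ut'].
  - by rewrite subrr normr0 mulr_ge0 // divr_ge0 ?ler0n.
  - by rewrite distrC; exact: br.
  - exact: br.
  - exact: tr.
move=> w a sa u; rewrite inE => /predU1P[->|]; last exact: th.
exact: barycenter_ball.
Qed.

Lemma sd_iter_mesh n m (r : K) s : (size s <= n.+1)%N -> 0 <= r ->
  mesh_le r s -> iter m (sd K R n) << s >> \in supported R
    [set t | size t = size s /\ mesh_le ((n%:R / n.+1%:R) ^+ m * r) t].
Proof.
move=> sn r0 sr; elim: m => [|m IH].
  by rewrite expr0 mul1r; apply: supportedU; split.
rewrite iterS; apply: supported_map IH => t [ts tr].
have tn : (size t <= n.+1)%N by rewrite ts.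
have rm0 : 0 <= (n%:R / n.+1%:R) ^+ m * r.
  by rewrite mulr_ge0 // exprn_ge0 // divr_ge0 ?ler0n.
apply: supportedS (sd_mesh tn rm0 tr) => q [qt qr _].
by split; [rewrite qt|rewrite exprS -mulrA].
Qed.

End Mesh.

(** * Subdivision of singular chains *)

Section SingularSubdivision.
Variables (K : realType) (R : nzRingType) (X : topologicalType).
Local Notation simplex n := (set_type (std_simplex K n)).

Definition push n (s : singular_simplex K X n) k :
    {linear lchain R (simplex n) -> chain K R X k} :=
  realize R (fun k (t : k.+1.-tuple (simplex n)) =>
    (s \o affine t : singular_simplex K X k)) k.

Lemma supportedT (S : choiceType) (c : {freeg S / R}) : c \in supported R setT.
Proof. exact/supportedP. Qed.

Lemma push_boundary n (s : singular_simplex K X n) k c :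
  boundary K R X k.+1 (push s k.+1 c) = push s k (dl R c).
Proof.
apply: (realize_boundary (P := setT)); last exact: supportedT.
by move=> m t i _ x /=; rewrite affine_face.
Qed.

Lemma push_in n (s : singular_simplex K X n) k c :
  push s k c \in chains_in (range s) k.
Proof.
apply: (realize_in (P := setT)); first exact: supportedT.
by move=> t _ _ [x _ <-] /=; exists (affine t x).
Qed.

Definition fundamental n : lchain R (simplex n) := << val (basis_tuple K n) >>.

Lemma lmap_face_fundamental n (i : 'I_n.+2) :
  lmap R (face K i) (fundamental n) = << del i (val (basis_tuple K n.+1)) >>.
Proof. by rewrite lmapU -val_del_tuple -face_basis. Qed.

Lemma push_basis n (s : singular_simplex K X n) :
  push s n (fundamental n) = << s >>.
Proof.
rewrite realizeU; congr << _ >>; apply/continuousEP => x /=.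
by rewrite affine_basis.
Qed.

Lemma push_comp m n (s : singular_simplex K X n)
    (g : continuousType (std_simplex K m) (std_simplex K n)) k c :
  linear_map g ->
  push (s \o g : singular_simplex K X m) k c = push s k (lmap R g c).
Proof.
move=> glin; apply: (realize_map (G := idfun) (P := setT)); last first.
  exact: supportedT.
move=> t _ /=; congr << _ >>; apply/continuousEP => x /=.
by rewrite affine_map.
Qed.

(** Subdivision of the identity simplex, transported by [push]; naturality under affine maps carries
    the simplicial identities over. *)
Definition subdivide n : {linear chain K R X n -> chain K R X n} :=
  fglift (fun s : singular_simplex K X n =>
    push s n (sd K R n (fundamental n))).

Definition subdivide_htpy n : {linear chain K R X n -> chain K R X n.+1} :=
  fglift (fun s : singular_simplex K X n =>
    push s n.+1 (sdh K R n (fundamental n))).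

Lemma subdivideU n s : subdivide n << s >> =
  push s n (sd K R n (fundamental n)).
Proof. exact: fgliftU. Qed.

Lemma subdivide_htpyU n s : subdivide_htpy n << s >> =
  push s n.+1 (sdh K R n (fundamental n)).
Proof. exact: fgliftU. Qed.

Lemma map_affine_basis m n (t : n.+1.-tuple (simplex m)) :
  map (affine t) (val (basis_tuple K n)) = t.
Proof.
rewrite -[LHS]/(val (map_tuple (affine t) (basis_tuple K n))); congr val.
apply: eq_from_tnth => i; rewrite tnth_map tnth_mktuple; apply/val_inj.
by rewrite /= -rowE rowK.
Qed.

Lemma subdivide_push n (s : singular_simplex K X n) k c :
  c \in supported R [set t | size t = k.+1] ->
  subdivide k (push s k c) = push s k (sd K R n c).
Proof.
apply: (supported_ext (f := subdivide k \o push s k)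
  (g := push s k \o sd K R n)) => t /tuple_of[u ->] /=.
rewrite realizeU subdivideU push_comp; last exact: affine_linear.
rewrite sd_map; last exact: affine_linear.
by rewrite [lmap _ _ _]lmapU map_affine_basis.
Qed.

Opaque subdivide subdivide_htpy push.

Lemma subdivide_htpy0 c :
  c - subdivide 0 c - boundary K R X 1 (subdivide_htpy 0 c) = 0.
Proof.
apply: (freeg_linear_ext (f := (idfun \- subdivide 0) \-
  (boundary K R X 1 \o subdivide_htpy 0)) (g := \0)) => s /=.
rewrite subdivideU -[fglift _ _]/(boundary K R X 1 _) subdivide_htpyU.
rewrite push_boundary sdh_dl !(linearB (push s 0)) push_basis opprB addrC subrK.
(* In the augmented complex a vertex has boundary [<< [::] >>], whereas [boundary] is 0 in degree 0;
   the discrepancy vanishes because [sdh] kills the empty sequence. *)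
have -> : dl R (fundamental 0) = << [::] >>.
  rewrite dlU.
  have [v ->] : exists v, val (basis_tuple K 0) = [:: v].
    by case/tupleP: (basis_tuple K 0) => v t; exists v; rewrite [t]tuple0.
  by rewrite dseq_cons dseq_nil !linear0 addr0.
by rewrite sdh_nil linear0.
Qed.

Lemma subdivide_htpyS n c : c - subdivide n.+1 c -
  boundary K R X n.+2 (subdivide_htpy n.+1 c) =
  subdivide_htpy n (boundary K R X n.+1 c).
Proof.
apply: (freeg_linear_ext (f := (idfun \- subdivide n.+1) \-
  (boundary K R X n.+2 \o subdivide_htpy n.+1))
  (g := subdivide_htpy n \o boundary K R X n.+1)) => s.
rewrite [LHS]/= -[fglift _ (subdivide_htpy _ _)]/(boundary K R X n.+2 _).
rewrite subdivideU subdivide_htpyU push_boundary sdh_dl !(linearB (push s n.+1)).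
rewrite push_basis opprB addrC subrK [dl _ _]dlU dseqE size_tuple.
rewrite /= fgliftU !linear_sum; apply: eq_bigr => i _.
rewrite !linearZ; congr (_ *: _); rewrite /= subdivide_htpyU push_comp.
  rewrite sdh_map; last exact: face_linear.
  by rewrite lmap_face_fundamental.
exact: face_linear.
Qed.

(** Every singular simplex is the push of the fundamental one, so [dl_dl] provides the cancellation
    of double faces. *)
Lemma boundary_boundary n c :
  boundary K R X n (boundary K R X n.+1 c) = 0.
Proof.
case: n c => [|n] c //.
apply: (freeg_linear_ext (f := boundary K R X n.+1 \o boundary K R X n.+2)
  (g := \0)) => s.
transitivity (boundary K R X n.+1 (boundary K R X n.+2
  (push s n.+2 (fundamental n.+2)))); first by rewrite push_basis.
by rewrite !push_boundary dl_dl linear0.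
Qed.

(** Applying the boundary to the homotopy identity [subdivide_htpyS] and cancelling leaves exactly
    this; no faces are computed. *)
Lemma subdivide_boundary n c :
  boundary K R X n (subdivide n c) = subdivide n.-1 (boundary K R X n c).
Proof.
case: n c => [|n] c; first by rewrite !linear0.
have H : boundary K R X n.+1 (subdivide_htpy n (boundary K R X n.+1 c)) =
    boundary K R X n.+1 c - subdivide n (boundary K R X n.+1 c).
  apply/esym/eqP; rewrite -subr_eq0; apply/eqP.
  case: n c => [|n] c; first exact: subdivide_htpy0.
  by rewrite subdivide_htpyS boundary_boundary linear0.
have := congr1 (boundary K R X n.+1) (subdivide_htpyS c).
rewrite H 2!linearB boundary_boundary subr0 => /eqP.
by rewrite (inj_eq (addrI _)) eqr_opp => /eqP.
Qed.

End SingularSubdivision.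
Opaque subdivide subdivide_htpy push.

(** * Small singular chains *)

Opaque boundary.

Section SmallChains.
Variables (K : realType) (R : nzRingType) (X : topologicalType).
Local Notation simplex n := (set_type (std_simplex K n)).
Local Notation subdivide := (@subdivide K R X).

Lemma chains_in_supported (A : set X) n (c : chain K R X n) :
  (c \in chains_in A n) =
  (c \in supported R [set s : singular_simplex K X n | range s `<=` A]).
Proof. by []. Qed.

Lemma chains_inS (A B : set X) n (c : chain K R X n) :
  A `<=` B -> c \in chains_in A n -> c \in chains_in B n.
Proof.
by move=> AB; rewrite !chains_in_supported; apply: supportedS => s /subset_trans; exact.
Qed.

Definition small (U V : set X) n : {pred chain K R X n} := supported R
  ([set s : singular_simplex K X n | range s `<=` U] `|` [set s | range s `<=` V]).

Lemma chains_in_map (A : set X) n m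
    (f : {linear chain K R X n -> chain K R X m}) :
  (forall s : singular_simplex K X n, f << s >> \in chains_in (range s) m) ->
  forall c, c \in chains_in A n -> f c \in chains_in A m.
Proof.
move=> fs c; rewrite chains_in_supported.
by apply: supported_map => s sA; exact: chains_inS (fs s).
Qed.

Arguments small U V n : clear implicits.
HB.instance Definition _ (U V : set X) n := GRing.SubmodClosed.on (small U V n).

Lemma small_map (U V : set X) n m
    (f : {linear chain K R X n -> chain K R X m}) :
  (forall s : singular_simplex K X n, f << s >> \in chains_in (range s) m) ->
  forall c, c \in small U V n -> f c \in small U V m.
Proof.
move=> fs c; apply: supported_map => s sUV.
have := fs s; rewrite chains_in_supported; apply: supportedS => t ts.
by case: sUV => sA; [left|right]; exact: subset_trans sA.
Qed.

Lemma small_split (U V : set X) n c : c \in small U V n ->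
  exists2 d, d \in chains_in U n & c - d \in chains_in V n.
Proof. exact: supported_split. Qed.

Lemma subdivide_in n s : subdivide n << s >> \in chains_in (range s) n.
Proof. by rewrite subdivideU; exact: push_in. Qed.

Lemma subdivide_htpy_in n (s : singular_simplex K X n) :
  subdivide_htpy K R X n << s >> \in chains_in (range s) n.+1.
Proof. by rewrite subdivide_htpyU; exact: push_in. Qed.

Lemma linear_iter (V : lmodType R) (f : {linear V -> V}) m :
  linear (iter m f).
Proof. by elim: m => [|m IH] a u v //=; rewrite IH linearP. Qed.

Lemma mesh_exists n (t : seq (simplex n)) : exists2 r : K, 0 <= r & mesh_le r t.
Proof.
exists (\sum_(u <- t) \sum_(v <- t) `|val u - val v|).
  by rewrite sumr_ge0 // => u _; rewrite sumr_ge0.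
move=> u v ut vt; rewrite (perm_big _ (perm_to_rem ut)) big_cons.
rewrite (perm_big _ (perm_to_rem vt)) big_cons /= -addrA lerDl.
by rewrite addr_ge0 ?sumr_ge0 // => w _; rewrite sumr_ge0.
Qed.

Lemma push_iter n (s : singular_simplex K X n) m :
  iter m (subdivide n) << s >> =
  push R s n (iter m (sd K R n) (fundamental K R n)).
Proof.
suff [//] : iter m (subdivide n) << s >> =
  push R s n (iter m (sd K R n) (fundamental K R n)) /\
  iter m (sd K R n) (fundamental K R n) \in
    supported R [set t | size t = n.+1].
elim: m => [|m [IH1 IH2]].
  split; first by rewrite /= push_basis.
  exact: (supportedU R (P := [set t | size t = n.+1]) (size_tuple (basis_tuple K n))).
rewrite !iterS IH1 subdivide_push //; split=> //.
apply: supported_map IH2 => t tn.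
have [r r0 tr] := mesh_exists t.
have tn' : (size t <= n.+1)%N by rewrite tn.
by apply: supportedS (sd_mesh R tn' r0 tr) => q [qt _ _] /=; rewrite qt.
Qed.

Lemma lebesgue_number n (s : singular_simplex K X n) (U V : set X) :
  open U -> open V -> range s `<=` U `|` V ->
  exists2 e : K, 0 < e & forall p : simplex n,
    (forall q : simplex n, `|val q - val p| < e -> U (s q)) \/
    (forall q : simplex n, `|val q - val p| < e -> V (s q)).
Proof.
move=> oU oV sUV.
have ball_in W (p : simplex n) : open W -> W (s p) -> exists2 e : K, 0 < e &
    forall q : simplex n, `|val q - val p| < e -> W (s q).
  move=> oW Wp; have /= [B [[C oC <-] Cp CW]] :=
    @cts_fun _ _ s p W (open_nbhs_nbhs (conj oW Wp)).
  have /nbhs_ballP[e /= e0 eC] := open_nbhs_nbhs (conj oC Cp).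
  exists e => // q qp; apply: CW; apply: eC.
  by rewrite -ball_normE /= distrC.
(* Compactness in the form: a property that holds near each point for all small radii holds on the
   whole simplex for one radius. *)
have /compact_near_coveringP cov := @std_simplex_compact K n.
pose P (e : K) (p : 'rV[K]_n.+1) :=
  (forall q : simplex n, `|val q - p| < e -> U (s q)) \/
  (forall q : simplex n, `|val q - p| < e -> V (s q)).
have PN W e (x : 'rV[K]_n.+1) : 0 < e ->
    (forall q : simplex n, `|val q - x| < e -> W (s q)) ->
    \forall x' \near x & d \near (0:K)^'+,
    forall q : simplex n, `|val q - x'| < d -> W (s q).
  (* Halving the radius leaves room, by the triangle inequality, for the centre to move. *)
  move=> e0 eW; exists (ball x (e / 2), [set d | 0 < d < e / 2]) => /=.
    split; first by apply: nbhsx_ballx; rewrite divr_gt0.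
    near=> d; apply/andP; split; near: d; first exact: nbhs_right_gt.
    by apply: nbhs_right_lt; rewrite divr_gt0.
  move=> [x' d] [/= xx' /andP[_ de]] q qx'; apply: eW.
  rewrite -ball_normE /= in xx'.
  rewrite -(subrK x' (val q)) -addrA (le_lt_trans (ler_normD _ _)) //.
  by rewrite (splitr e) ltrD // ?(lt_trans qx') // distrC.
have /cov : forall x, std_simplex K n x ->
    \forall x' \near x & d \near (0:K)^'+, P d x'.
  move=> x xS; have [Ux|Vx] : (U `|` V) (s (to_simplex xS)).
  - by apply: sUV; exists (to_simplex xS).
  - have [e e0 eU] := ball_in _ _ oU Ux.
    by apply: filterS (PN U e x e0 eU) => z zW; left.
  - have [e e0 eV] := ball_in _ _ oV Vx.
    by apply: filterS (PN V e x e0 eV) => z zW; right.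
move=> H; have [e [e0 eP]] : exists e : K, 0 < e /\ (std_simplex K n `<=` P e).
  have [e [eP e0]] := filter_ex (filterI H (nbhs_right_gt (0 : K))).
  by exists e.
by exists e => // p; apply: eP; exact: set_valP.
Unshelve. all: by end_near.
Qed.

(** All large [m] are asserted, not just one, so that a linear combination can take the maximum of
    two bounds. *)
Lemma subdivide_small n (A U V : set X) c : open U -> open V ->
  A `<=` U `|` V -> c \in chains_in A n ->
  exists m0, forall m, (m0 <= m)%N ->
  iter m (subdivide n) c \in small (A `&` U) (A `&` V) n.
Proof.
move=> oU oV AUV; rewrite chains_in_supported.
apply: (supported_ind (Q := fun c => exists m0, forall m, (m0 <= m)%N ->
  iter m (subdivide n) c \in small (A `&` U) (A `&` V) n) (f := idfun)).
- exists 0 => m _; have -> : iter m (subdivide n) 0 = 0.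
    by elim: m => //= m ->; rewrite linear0.
  exact: rpred0.
- move=> a u v [m1 um] [m2 vm]; exists (maxn m1 m2) => m.
  rewrite geq_max => /andP[m1m m2m].
  by rewrite linear_iter rpredD ?rpredZ ?um ?vm.
move=> s sA /=.
have [e e0 eUV] := lebesgue_number oU oV (subset_trans sA AUV).
pose t := val (basis_tuple K n).
have [r r0 tr] := mesh_exists t.
have [m0 m0e] : exists m0, forall m, (m0 <= m)%N ->
    (n%:R / n.+1%:R) ^+ m * r < e.
  have n1 : `|n%:R / n.+1%:R : K| < 1.
    by rewrite ger0_norm ?divr_ge0 // ltr_pdivrMr ?ltr0n // mul1r ltr_nat.
  have lim : (n%:R / n.+1%:R) ^+ m * r @[m --> \oo] --> (0 : K).
    by rewrite -(mul0r r); apply: cvgMr_tmp; exact: cvg_expr.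
  have [m0 _ m0e] := (cvgrPdist_lt _ _).1 lim e e0.
  exists m0 => m /m0e; rewrite /= sub0r normrN; apply: le_lt_trans.
  exact: ler_norm.
exists m0 => m /m0e me; rewrite push_iter.
have tn : (size t <= n.+1)%N by rewrite size_tuple.
apply: supported_map (sd_iter_mesh R m tn r0 tr) => q [qn qe].
have [q' E] := tuple_of (etrans qn (size_tuple _)).
rewrite E realizeU; rewrite E in qe.
have near0 x : `|val (affine q' x) - val (tnth q' ord0)| < e.
  apply: le_lt_trans me; apply: affine_ball => i.
  by apply: qe; rewrite mem_tnth.
rewrite /small; apply: supportedU.
have [pU|pV] := eUV (tnth q' ord0); [left|right] => _ [x _ <-] /=.
  by split; [apply: sA; exists (affine q' x)|exact: pU (near0 x)].
by split; [apply: sA; exists (affine q' x)|exact: pV (near0 x)].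
Qed.

(** By the homotopy identity the difference is the homotopy applied to the boundary (0 in degree 0),
    and the homotopy keeps each simplex inside its image. *)
Lemma small_htpy (U V : set X) n c : boundary K R X n c \in small U V n.-1 ->
  c - subdivide n c - boundary K R X n.+1 (subdivide_htpy K R X n c) \in small U V n.
Proof.
case: n c => [|n] c; first by rewrite subdivide_htpy0 rpred0.
by rewrite subdivide_htpyS; apply: small_map; exact: subdivide_htpy_in.
Qed.

(** Only the boundary of [c] is required to be small: [c] will be the singular part of a
    mapping-cone cycle, whose boundary is simplicial and in general not 0. *)
Lemma small_chains n (A U V : set X) c : open U -> open V -> A `<=` U `|` V ->
  c \in chains_in A n -> boundary K R X n c \in small (A `&` U) (A `&` V) n.-1 ->
  exists2 d, d \in chains_in A n.+1 &
    c - boundary K R X n.+1 d \in small (A `&` U) (A `&` V) n.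
Proof.
move=> oU oV AUV cA bc.
have [m /(_ _ (leqnn m))] := subdivide_small oU oV AUV cA.
elim: m c cA bc => [|m IH] c cA bc; last first.
  rewrite iterSr => /IH[||d dA dS].
  - by apply: chains_in_map cA; exact: subdivide_in.
  - by rewrite subdivide_boundary; apply: small_map bc; exact: subdivide_in.
  exists (d + subdivide_htpy K R X n c).
    by rewrite rpredD //; apply: chains_in_map cA; exact: subdivide_htpy_in.
  have -> : c - boundary K R X n.+1 (d + subdivide_htpy K R X n c) =
      (subdivide n c - boundary K R X n.+1 d) +
      (c - subdivide n c - boundary K R X n.+1 (subdivide_htpy K R X n c)).
    rewrite linearD opprD addrA [RHS]addrA (addrC (subdivide n c - _)).
    by rewrite subrKA.
  by rewrite rpredD //; exact: small_htpy.
by move=> cS; exists 0; [exact: rpred0|rewrite !linear0 addr0].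
Qed.

End SmallChains.
Arguments small {K R X} U V n.

(** * Order complexes of finite spaces *)

Section Specialization.
Variables (X : topologicalType).

(* The specialization preorder: x lies in the closure of y. *)
Definition spec_le : rel X :=
  fun x y => `[< forall O : set X, open O -> O x -> O y >].

Lemma spec_leP x y :
  reflect (forall O : set X, open O -> O x -> O y) (spec_le x y).
Proof. exact: asboolP. Qed.

Lemma spec_le_refl : reflexive spec_le.
Proof. by move=> x; apply/spec_leP. Qed.

Lemma spec_le_trans : transitive spec_le.
Proof.
by move=> y x z /spec_leP xy /spec_leP yz; apply/spec_leP => O oO /xy-/(_ oO)/yz; exact.
Qed.

Lemma closure1P x y : closure [set y] x <-> spec_le x y.
Proof.
split=> [cyx|/spec_leP xy B]; last first.
  rewrite nbhsE => -[O [oO Ox] OB]; exists y; split=> //.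
  by apply: OB; exact: xy.
apply/spec_leP => O oO Ox.
by have [z [-> ]] := cyx O (open_nbhs_nbhs (conj oO Ox)).
Qed.

Lemma closed_spec_le (A : set X) x y : closed A -> spec_le x y -> A y -> A x.
Proof.
move=> cA /spec_leP xy Ay; apply: contrapT => nAx.
by have := xy (~` A) (closed_openC cA) nAx.
Qed.

(** By finiteness the complement is a finite union of closures of points. These up-sets are the
    minimal open neighbourhoods. *)
Lemma open_up (x : X) : finite_set [set: X] -> open [set y | spec_le x y].
Proof.
move=> finX; rewrite -[X in open X]setCK; apply: closed_openC.
have -> : ~` [set y | spec_le x y] =
    \bigcup_(w in [set w | ~~ spec_le x w]) closure [set w].
  apply/seteqP; split=> [y /negP xy|y [w /= xw /closure1P yw] /= xy].
    by exists y => //; apply: subset_closure.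
  by move/negP: xw; apply; exact: spec_le_trans yw.
apply: closed_bigcup => [|w _]; last exact: closed_closure.
exact: sub_finite_set finX.
Qed.

Lemma minimal_spec (A : set X) : finite_set A -> A !=set0 ->
  exists2 x, A x & forall y, A y -> spec_le y x -> spec_le x y.
Proof.
move=> /finite_seqP[l ->]; have [n] := ubnP (size l).
elim: n l => // n IH l ln [x /= xl].
(* Only elements strictly below [x] are kept, so [x] itself drops out and the list shrinks. *)
pose l' := [seq y <- l | spec_le y x && ~~ spec_le x y].
have [l'0|[y yl']] : l' = [::] \/ exists y, y \in l'.
- by case: (l') => [|y r]; [left|right; exists y; exact: mem_head].
- exists x => // y yl yx; apply: contraT => xy.
  have : y \in l' by rewrite mem_filter yx xy yl.
  by rewrite l'0.
- have l'n : (size l' < n)%N.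
    rewrite -ltnS (leq_trans _ ln) // ltnS size_filter.
    rewrite ltn_neqAle count_size andbT -all_count; apply/allPn.
    by exists x; rewrite //= spec_le_refl andbF.
  have [|z] := IH l' l'n; first by exists y.
  rewrite /= mem_filter => /andP[/andP[zx nxz] zl] zmin; exists z => // w wl wz.
  apply: zmin => //; rewrite /= mem_filter wl andbT (spec_le_trans wz zx) /=.
  by apply: contra nxz => xw; exact: spec_le_trans wz.
Qed.

(** Here [n] counts vertices, one more than the dimension. Repetitions are allowed, so a continuous
    map sends chains to chains with no degenerate simplices to discard. *)
Definition nerve (A : set X) n : set (seq X) :=
  [set s | [/\ sorted spec_le s, (forall x, x \in s -> A x) & size s = n]].

Lemma nerve_subseq A n s t : subseq t s -> nerve A n s -> nerve A (size t) t.
Proof.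
move=> ts [ss sA _]; split=> //.
  exact: (subseq_sorted spec_le_trans ts).
by move=> x /(mem_subseq ts); exact: sA.
Qed.

Lemma nerve_face A n s t : nerve A n s -> face_of s t -> nerve A n.-1 t.
Proof.
move=> sA [ts st]; have [_ _ sn] := sA.
by have := nerve_subseq ts sA; rewrite -sn st.
Qed.

Lemma nerveS A B n : A `<=` B -> nerve A n `<=` nerve B n.
Proof. by move=> AB s [ss sA sn]; split=> // x /sA/AB. Qed.

Lemma dl_nerve (R : nzRingType) A n c : c \in supported R (nerve A n) ->
  dl R c \in supported R (nerve A n.-1).
Proof.
apply: supported_map => s sA; rewrite dlU.
by apply: supportedS (dseq_face R s) => t; exact: nerve_face.
Qed.

End Specialization.

Lemma spec_le_continuous (X Y : topologicalType) (f : X -> Y) x y :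
  continuous f -> spec_le x y -> spec_le (f x) (f y).
Proof.
move=> /continuousP fc /spec_leP xy; apply/spec_leP => O oO.
by apply: (xy (f @^-1` O)); exact: fc.
Qed.

(** * McCord's map on simplices *)

Section OrderSimplex.
Variables (K : realType) (R : nzRingType).
Local Notation simplex n := (set_type (std_simplex K n)).

Definition is_top n (t : simplex n) (j : 'I_n.+1) :=
  0 < (val t) 0 j /\ forall k : 'I_n.+1, (j < k)%N -> (val t) 0 k = 0.

Lemma is_top_ex n (t : simplex n) : exists j, is_top t j.
Proof.
have [i ti] : exists i, 0 < (val t) 0 i.
  apply: contrapT => tn; have := oner_neq0 K.
  rewrite -(simplex_sum t) big1 ?eqxx // => i _; apply/eqP.
  rewrite eq_le simplex_ge0 andbT leNgt; apply/negP => ti.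
  by apply: tn; exists i.
have := @arg_maxnP _ i (fun i => 0 < (val t) 0 i) val ti.
case=> j tj jmax; exists j; split=> // k jk; apply/eqP.
rewrite eq_le simplex_ge0 andbT leNgt; apply/negP => /jmax kj.
by move: jk; rewrite ltnNge => /negP; apply; exact: kj.
Qed.

Definition top n (t : simplex n) : 'I_n.+1 := xget ord0 [set j | is_top t j].

Lemma topP n (t : simplex n) : is_top t (top t).
Proof. by have := xgetPex ord0 (is_top_ex t). Qed.

Lemma top_unique n (t : simplex n) j : is_top t j -> top t = j.
Proof.
have [t0 tmax] := topP t => -[j0 jmax]; apply/ord_inj/eqP.
rewrite eqn_leq leqNgt (leqNgt j); apply/andP; split; apply/negP.
  by move=> /jmax E; rewrite E ltxx in t0.
by move=> /tmax E; rewrite E ltxx in j0.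
Qed.

Lemma top_face n (i : 'I_n.+2) (t : simplex n) :
  top (face K i t) = fintype.lift i (top t).
Proof.
have [t0 tmax] := topP t; apply: top_unique; split.
  by rewrite /= mxE liftK.
move=> k; rewrite /= mxE; case: unliftP => [j ->|->] //= ij.
by apply: tmax; rewrite ltnNge -(leq_bump2 i) -ltnNge.
Qed.

Variable X : topologicalType.

(* McCord's map: a point of the simplex goes to the vertex of largest index in
   its support, so that preimages of up-sets are open. *)
Definition order_fun n (s : n.+1.-tuple X) (t : simplex n) := tnth s (top t).

(** Near [t] the coordinate of index [top t] stays positive, so [top] can only grow; the values then
    move up in the preorder, and open sets are up-sets. *)
Lemma order_continuous n (s : n.+1.-tuple X) :
  sorted (@spec_le X) s -> continuous (order_fun s).
Proof.
move=> ss t A; rewrite nbhsE => -[O [oO Ot] OA]; have [t0 _] := topP t.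
have ct : {for t, continuous (fun u : std_simplex K n => (val u) 0 (top t))}.
  apply: (@continuous_comp _ _ _ (@set_val _ (std_simplex K n))
    (fun u : 'rV[K]_n.+1 => u 0 (top t))); first exact: initial_continuous.
  exact: coord_continuous.
have : nbhs t [set u : std_simplex K n | 0 < (val u) 0 (top t)].
  by apply: (ct [set x | 0 < x]); exact: lt_nbhsr.
apply: filterS => u ut; apply: OA.
have tu : (top t <= top u)%N.
  rewrite leqNgt; apply/negP => ltop; have [_ /(_ _ ltop) E] := topP u.
  by move: ut; rewrite /= E ltxx.
have : spec_le (order_fun s t) (order_fun s u).
  have x0 := tnth s ord0; rewrite /order_fun !(tnth_nth x0).
  by apply: (sorted_leq_nth (@spec_le_trans X) (@spec_le_refl X)) => //;
    rewrite inE size_tuple ltn_ord.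
by move=> /spec_leP; apply.
Qed.

(** Unsorted tuples get a constant simplex: [realize] needs a total function, and a vertex as value
    keeps [order_simplex_range] valid for every tuple. *)
Definition order_simplex n (s : n.+1.-tuple X) : singular_simplex K X n :=
  if pselect (sorted (@spec_le X) s) is left h then mkcts (order_continuous h)
  else mkcts (@cst_continuous _ _ (tnth s ord0)).

Lemma order_simplexE n (s : n.+1.-tuple X) t :
  sorted (@spec_le X) s -> order_simplex s t = tnth s (top t).
Proof. by move=> ss; rewrite /order_simplex; case: pselect. Qed.

Lemma order_simplex_range n (s : n.+1.-tuple X) (A : set X) :
  (forall x, x \in tval s -> A x) -> range (order_simplex s) `<=` A.
Proof.
move=> sA _ [t _ <-]; apply: sA; rewrite /order_simplex.
by case: pselect => ? /=; exact: mem_tnth.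
Qed.

Definition order_chain n : {linear lchain R X -> chain K R X n} :=
  realize R order_simplex n.

Lemma order_chainU n (s : n.+1.-tuple X) :
  order_chain n << val s >> = << order_simplex s >>.
Proof. exact: realizeU. Qed.

Lemma order_chain_boundary A n m c : c \in supported R (nerve A m) ->
  boundary K R X n.+1 (order_chain n.+1 c) = order_chain n (dl R c).
Proof.
apply: realize_boundary => {}n s i [ss _ _] t /=.
rewrite !order_simplexE ?top_face ?tnth_mktuple //.
rewrite val_del_tuple; apply: (subseq_sorted (@spec_le_trans X)) ss.
rewrite -{2}[tval s](cat_take_drop i) cat_subseq //.
by rewrite -add1n -drop_drop drop_subseq.
Qed.

Lemma order_chain_in A n m c : c \in supported R (nerve A m) ->
  order_chain n c \in chains_in A n.
Proof.
move=> cA; apply: realize_in cA _ => s [_ sA _]; exact: order_simplex_range.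
Qed.

End OrderSimplex.

Opaque order_chain.

(** * Singular cones over a least element *)

Section ConeSimplex.
Variables (K : realType) (R : nzRingType) (X : topologicalType).
Local Notation simplex n := (set_type (std_simplex K n)).

Definition opposite_mx n (t : 'rV[K]_n.+2) : 'rV[K]_n.+1 :=
  \row_j (t 0 (fintype.lift ord0 j) / (1 - t 0 ord0)).

Lemma opposite_simplex n (t : simplex n.+1) : (val t) 0 ord0 != 1 ->
  std_simplex K n (opposite_mx (val t)).
Proof.
move=> t1; have t0 : 1 - (val t) 0 ord0 != 0 by rewrite subr_eq0 eq_sym.
split=> [j|].
  by rewrite mxE divr_ge0 ?simplex_ge0 // subr_ge0 simplex_le1.
under eq_bigr do rewrite mxE.
rewrite -mulr_suml; apply/(mulIf t0); rewrite divfK // mul1r.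
by rewrite -(simplex_sum t) [in RHS]big_ord_recl addrC addKr.
Qed.

(* Projection from the vertex 0, with a junk value at that vertex. *)
Definition opposite n (t : simplex n.+1) : simplex n :=
  if pselect ((val t) 0 ord0 != 1) is left h then
    to_simplex (opposite_simplex h) else basis K ord0.

Lemma val_opposite n (t : simplex n.+1) : (val t) 0 ord0 != 1 ->
  val (opposite t) = opposite_mx (val t).
Proof. by move=> t1; rewrite /opposite; case: pselect. Qed.

Lemma opposite_face0 n (t : simplex n) : opposite (face K ord0 t) = t.
Proof.
have t0 : (val (face K ord0 t)) 0 ord0 = 0.
  by rewrite /= mxE unlift_none.
apply/val_inj; rewrite val_opposite; last by rewrite t0 eq_sym oner_eq0.
apply/rowP => j; rewrite mxE t0 subr0 divr1 /= mxE.
by rewrite liftK.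
Qed.

Lemma face_lift_ord0 n (i : 'I_n.+2) (t : simplex n.+1) :
  (val (face K (fintype.lift ord0 i) t)) 0 ord0 = (val t) 0 ord0.
Proof.
rewrite /= mxE.
have -> : ord0 = fintype.lift (fintype.lift ord0 i) ord0 :> 'I_n.+3.
  exact/ord_inj.
by rewrite liftK.
Qed.

Lemma opposite_face n (i : 'I_n.+2) (t : simplex n.+1) :
  (val t) 0 ord0 != 1 ->
  opposite (face K (fintype.lift ord0 i) t) = face K i (opposite t).
Proof.
move=> t1; apply/val_inj; rewrite val_opposite; last by rewrite face_lift_ord0.
apply/rowP => j; rewrite mxE face_lift_ord0 /= !mxE val_opposite //.
case: (unliftP i j) => [k ->|->] /=; last first.
  by rewrite unlift_none mul0r.
rewrite mxE.
have -> : fintype.lift ord0 (fintype.lift i k) =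
    fintype.lift (fintype.lift ord0 i) (fintype.lift ord0 k).
  apply/ord_inj; rewrite /= /bump /= !add1n ltnS.
  by rewrite addnS.
by rewrite liftK.
Qed.

Lemma coord_simplex_continuous n (i : 'I_n.+1) :
  continuous (fun t : std_simplex K n => (val t) 0 i).
Proof.
move=> t; apply: (@continuous_comp _ _ _ (@set_val _ (std_simplex K n))
  (fun u : 'rV[K]_n.+1 => u 0 i)); first exact: initial_continuous.
exact: coord_continuous.
Qed.

Lemma opposite_continuous_at n (t : std_simplex K n.+1) :
  (val t) 0 ord0 != 1 -> {for t, continuous (@opposite n)}.
Proof.
move=> t1 A [/= B [[C oC <-] Ct CA]].
have nt1 : nbhs t [set u : std_simplex K n.+1 | (val u) 0 ord0 != 1].
  apply: (@coord_simplex_continuous _ ord0 t [set x | x != 1]).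
  apply: open_nbhs_nbhs; split=> //; exact: open_neq.
have : {for t, continuous (fun u : std_simplex K n.+1 => opposite_mx (val u))}.
  apply: row_continuous => j.
  have -> : (fun u : std_simplex K n.+1 => opposite_mx (val u) 0 j) =
     (fun u => (val u) 0 (fintype.lift ord0 j) * (1 - (val u) 0 ord0)^-1).
    by apply/funext => u; rewrite mxE.
  have t0 : 1 - (val t) 0 ord0 != 0 by rewrite subr_eq0 eq_sym.
  exact: (cvgM (@coord_simplex_continuous _ (fintype.lift ord0 j) t)
    (cvgV t0 (cvgB (@cvg_cst _ (1 : K) _ (nbhs t) _)
                   (@coord_simplex_continuous _ ord0 t)))).
move=> /(_ C) /=; have -> : opposite_mx (val t) = val (opposite t).
  by rewrite val_opposite.
move=> /(_ (open_nbhs_nbhs (conj oC Ct))) H.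
apply: filterS (filterI nt1 H) => u [u1 Cu]; apply: CA.
suff : C (val (opposite u)) by [].
by rewrite val_opposite.
Qed.

Definition cone_fun n (x : X) (s : singular_simplex K X n)
    (t : simplex n.+1) : X :=
  if (val t) 0 ord0 == 1 then x else s (opposite t).

(** At the apex the behaviour of [opposite] does not matter: every open neighbourhood of [x]
    contains all points above [x], hence the whole image of the cone. *)
Lemma cone_fun_continuous n (x : X) (s : singular_simplex K X n) :
  (forall y, range s y -> spec_le x y) -> continuous (cone_fun x s).
Proof.
move=> xs t A; have [t1|t1] := eqVneq ((val t) 0 ord0) 1.
  rewrite /cone_fun t1 eqxx nbhsE => -[O [oO Ox] OA].
  suff : nbhs t (cone_fun x s @^-1` A) by [].
  apply: filterE => u; apply: OA; rewrite /cone_fun; case: eqVneq => // _.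
  have /spec_leP := xs (s (opposite u)) (ex_intro2 _ _ (opposite u) I erefl).
  by apply.
rewrite {1}/cone_fun (negPf t1) => At.
have nt1 : nbhs t [set u : std_simplex K n.+1 | (val u) 0 ord0 != 1].
  apply: (@coord_simplex_continuous _ ord0 t [set x | x != 1]).
  apply: open_nbhs_nbhs; split=> //; exact: open_neq.
have : nbhs t ((s \o @opposite n : std_simplex K n.+1 -> X) @^-1` A).
  apply: (@continuous_comp _ _ _ (@opposite n) s t) At.
    exact: opposite_continuous_at.
  exact: cts_fun.
move=> H; apply: filterS (filterI nt1 H) => u [/= u1 Au].
by rewrite /cone_fun (negPf u1).
Qed.

Definition cone_simplex n (x : X) (s : singular_simplex K X n) :
    singular_simplex K X n.+1 :=
  if pselect (forall y, range s y -> spec_le x y) is left h then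
    mkcts (cone_fun_continuous h)
  else mkcts (@cst_continuous _ _ x).

Definition singular_cone (x : X) n :
    {linear chain K R X n -> chain K R X n.+1} :=
  fglift (fun s : singular_simplex K X n => << cone_simplex x s >>).

Lemma singular_coneU x n s : singular_cone x n << s >> = << cone_simplex x s >>.
Proof. exact: fgliftU. Qed.

Lemma cone_simplexE n x (s : singular_simplex K X n) t :
  (forall y, range s y -> spec_le x y) -> cone_simplex x s t = cone_fun x s t.
Proof. by move=> h; rewrite /cone_simplex; case: pselect. Qed.

Lemma cone_simplex_range n x (A : set X) (s : singular_simplex K X n) : A x ->
  range s `<=` A -> range (cone_simplex x s) `<=` A.
Proof.
move=> Ax sA _ [t _ <-]; rewrite /cone_simplex; case: pselect => //= ?.
suff : A (cone_fun x s t) by [].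
by rewrite /cone_fun; case: eqVneq => // _; apply: sA; exists (opposite t).
Qed.

Variables (A : set X) (x : X).
Hypotheses (Ax : A x) (xA : forall y, A y -> spec_le x y).

Lemma singular_cone_in n c : c \in chains_in A n ->
  singular_cone x n c \in chains_in A n.+1.
Proof.
rewrite chains_in_supported; apply: supported_map => s sA.
by rewrite singular_coneU; apply: chains_inU; exact: cone_simplex_range.
Qed.

Lemma cone_simplex_face0 n (s : singular_simplex K X n) : range s `<=` A ->
  cone_simplex x s \o face K ord0 =1 s.
Proof.
move=> sA t; rewrite [LHS]/= cone_simplexE; last by move=> y /sA/xA.
rewrite /cone_fun opposite_face0 /= mxE unlift_none.
by rewrite eq_sym oner_eq0.
Qed.

Lemma cone_simplex_face n (s : singular_simplex K X n.+1) i :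
  range s `<=` A -> cone_simplex x s \o face K (fintype.lift ord0 i) =1
  cone_simplex x (s \o face K i : singular_simplex K X n).
Proof.
move=> sA t; have s1 y : range s y -> spec_le x y by move=> /sA/xA.
have s2 y : range (s \o face K i) y -> spec_le x y.
  by case=> z _ <-; apply: s1; exists (face K i z).
rewrite [LHS]/= !cone_simplexE // /cone_fun face_lift_ord0.
by case: eqVneq => // t1; rewrite opposite_face.
Qed.

Lemma singular_cone_boundaryS n c : c \in chains_in A n.+1 ->
  boundary K R X n.+2 (singular_cone x n.+1 c) =
  c - singular_cone x n (boundary K R X n.+1 c).
Proof.
rewrite chains_in_supported; apply: (supported_ext
  (f := boundary K R X n.+2 \o singular_cone x n.+1)
  (g := idfun \- (singular_cone x n \o boundary K R X n.+1))) => s sA.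
rewrite /= singular_coneU !boundaryU big_ord_recl expr0 scale1r; congr (_ + _).
  congr << _ >>; apply/continuousEP; exact: cone_simplex_face0.
rewrite linear_sum -sumrN; apply: eq_bigr => i _.
rewrite linearZ /= singular_coneU /bump /= add1n exprS mulN1r scaleNr.
congr (- (_ *: << _ >>)); apply/continuousEP; exact: cone_simplex_face.
Qed.

(** Valued in multiples of the empty sequence, so that it continues the comparison with
    [order_chain] down to degree -1. *)
Definition augmentation : {linear chain K R X 0 -> lchain R X} :=
  fglift (fun _ => << [::] >> : lchain R X).

Lemma augmentation_boundary c : augmentation (boundary K R X 1 c) = 0.
Proof.
apply: (freeg_linear_ext (f := augmentation \o boundary K R X 1) (g := \0)).
move=> s; rewrite /= boundaryU linear_sum !big_ord_recr big_ord0 /=.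
by rewrite !linearZ /= !fgliftU expr0 expr1 scaleN1r scale1r add0r subrr.
Qed.

Lemma augmentation_order_chain c : c \in supported R (nerve setT 1) ->
  augmentation (order_chain K R X 0 c) = dl R c.
Proof.
apply: (supported_ext (f := augmentation \o order_chain K R X 0) (g := dl R)).
move=> s [_ _ s1]; have [t ->] := tuple_of s1.
rewrite /= order_chainU fgliftU dlU; case/tupleP: t => y t; rewrite tuple0 /=.
by rewrite dseq_cons dseq_nil !linear0 addr0.
Qed.

Lemma order_chain0_surj (B : set X) c : c \in chains_in B 0 ->
  exists2 t, t \in supported R (nerve B 1) & order_chain K R X 0 t = c.
Proof.
rewrite chains_in_supported; apply: (supported_ind (Q := fun c => exists2 t,
  t \in supported R (nerve B 1) & order_chain K R X 0 t = c) (f := idfun)).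
- by exists 0; [exact: rpred0|exact: linear0].
- move=> a _ _ [u uB <-] [v vB <-]; exists (a *: u + v).
    by rewrite rpredD ?rpredZ.
  by rewrite linearP.
move=> s sB /=; have b0 := basis K (@ord0 0).
exists << [:: s b0] >>.
  apply: supportedU; split=> //= y; rewrite inE => /eqP ->.
  by apply: sB; exists b0.
rewrite -[[:: s b0]]/(val [tuple s b0]) order_chainU; congr << _ >>.
apply/continuousEP => t; rewrite order_simplexE //.
rewrite (ord1 (top t)) tnth0; congr (s _); apply/val_inj/rowP => i.
rewrite (ord1 i).
have E (u : simplex 0) : (val u) 0 0 = 1.
  by rewrite -(simplex_sum u) big_ord_recl big_ord0 addr0.
by rewrite !E.
Qed.

Lemma singular_cone_boundary0 c : c \in chains_in A 0 -> augmentation c = 0 ->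
  boundary K R X 1 (singular_cone x 0 c) = c.
Proof.
(* In degree 0 the second face of the cone over a point is the apex, hence the correction by the
   augmentation. *)
have phix : forall c, c \in chains_in A 0 ->
    boundary K R X 1 (singular_cone x 0 c) =
    c - order_chain K R X 0 (cone R x (augmentation c)).
  move=> {}c; rewrite chains_in_supported; apply: (supported_ext
    (f := boundary K R X 1 \o singular_cone x 0)
    (g := idfun \- (order_chain K R X 0 \o (cone R x \o augmentation)))) => s sA.
  rewrite /= singular_coneU boundaryU fgliftU coneU !big_ord_recl big_ord0 addr0.
  rewrite expr0 scale1r expr1 scaleN1r; congr (_ - _).
    congr << _ >>; apply/continuousEP; exact: cone_simplex_face0.
  rewrite -[[:: x]]/(val [tuple x]) order_chainU; congr << _ >>.
  apply/continuousEP => t; rewrite order_simplexE // (ord1 (top t)) tnth0.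
  rewrite [LHS]/= cone_simplexE; last by move=> y /sA/xA.
  rewrite /cone_fun /= mxE.
  have -> : ord0 = fintype.lift (fintype.lift ord0 ord0) ord0 :> 'I_2.
    exact/ord_inj.
  rewrite liftK /=.
  have -> : (val t) 0 ord0 = 1.
    by rewrite -(simplex_sum t) big_ord_recl big_ord0 addr0.
  by rewrite eqxx.
by move=> cA c0; rewrite phix // c0 !linear0 addr0.
Qed.

End ConeSimplex.
Opaque singular_cone augmentation.

(** * McCord's theorem *)

Lemma supported0 (R : nzRingType) (S : choiceType) (P : set S) c :
  (forall s, ~ P s) -> c \in supported R P -> c = 0.
Proof.
by move=> nP; apply: (supported_ext (f := idfun) (g := \0)) => s /nP.
Qed.

Lemma sorted_comparable (X : topologicalType) (s : seq X) y z :
  sorted (@spec_le X) s -> y \in s -> z \in s -> spec_le y z || spec_le z y.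
Proof.
have mono := sorted_leq_nth (@spec_le_trans X) (@spec_le_refl X) y.
move=> ss ys zs.
have iy : index y s \in [pred n | n < size s]%N by rewrite inE index_mem.
have iz : index z s \in [pred n | n < size s]%N by rewrite inE index_mem.
apply/orP; have [yz|/ltnW zy] := leqP (index y s) (index z s); [left|right].
  by have := mono s ss _ _ iy iz yz; rewrite !nth_index.
by have := mono s ss _ _ iz iy zy; rewrite !nth_index.
Qed.

Section McCord.
Variables (K : realType) (R : nzRingType) (X : topologicalType).
Hypothesis finX : finite_set [set: X].
Local Notation order_chain := (@order_chain K R X).
Local Notation bd := (@boundary K R X).
Local Notation NC A n := (supported R (@nerve X A n)).

(* Acyclicity of the mapping cone of [order_chain], restricted to A. *)
Definition mccord (A : set X) := forall n s c,
  s \in NC A n.+1 -> dl R s = 0 -> c \in chains_in A n.+1 ->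
  bd n.+1 c = order_chain n s ->
  exists t d, [/\ t \in NC A n.+2, d \in chains_in A n.+2, dl R t = s &
    c - order_chain n.+1 t = bd n.+2 d].

Lemma cone_nerve (A : set X) x n c : A x -> (forall y, A y -> spec_le x y) ->
  c \in NC A n -> cone R x c \in NC A n.+1.
Proof.
move=> Ax xA; apply: supported_map => s [ss sA sn]; rewrite coneU.
apply: supportedU; split; last by rewrite /= sn.
  case: s ss sA {sn} => //= y s ys sA; rewrite ys andbT.
  by apply: xA; apply: sA; rewrite mem_head.
by move=> y; rewrite inE => /predU1P[->//|]; exact: sA.
Qed.

(** The cone at [x] fills the simplicial part; what is left of [c] is an honest cycle, filled by the
    singular cone. *)
Lemma mccord_min (A : set X) x :
  A x -> (forall y, A y -> spec_le x y) -> mccord A.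
Proof.
move=> Ax xA n s c sA ds cA bc; exists (cone R x s).
have tA := cone_nerve Ax xA sA.
have dt : dl R (cone R x s) = s by rewrite dl_cone ds !linear0 addr0.
have eA : c - order_chain n.+1 (cone R x s) \in chains_in A n.+1.
  by rewrite rpredB // (order_chain_in _ _ tA).
have be : bd n.+1 (c - order_chain n.+1 (cone R x s)) = 0.
  by rewrite linearB bc (order_chain_boundary _ _ tA) dt subrr.
exists (singular_cone K R x n.+1 (c - order_chain n.+1 (cone R x s))); split=> //.
  exact: singular_cone_in.
by rewrite (singular_cone_boundaryS xA) // be !linear0 addr0.
Qed.

Lemma boundary_in (A : set X) n c : c \in @chains_in K R X A n.+1 ->
  bd n.+1 c \in chains_in A n.
Proof.
apply: chains_in_map => s; rewrite boundaryU rpred_sum // => i _.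
by rewrite rpredZ // chains_inU // => _ [x _ <-]; exists (face K i x).
Qed.

(** The cycle condition of the augmented mapping cone; in the lowest degree the augmentation
    replaces the boundary. *)
Definition cone_cycle n : chain K R X n -> lchain R X -> Prop :=
  if n is m.+1 return chain K R X n -> lchain R X -> Prop
  then fun c s => bd m.+1 c = order_chain m s else fun c s => augmentation K R X c = s.

(** The differential of the mapping cone squares to zero, with its sign on the simplicial part. *)
Lemma cone_cycle_sub n c s : s \in NC setT n.+1 ->
  cone_cycle (bd n.+1 c - order_chain n s) (- dl R s).
Proof.
case: n c => [|n] c sT /=.
  by rewrite linearB augmentation_boundary augmentation_order_chain ?sub0r.
by rewrite linearB boundary_boundary sub0r linearN (order_chain_boundary _ _ sT).
Qed.

(** Degree 0 is settled by [order_chain] being onto 0-chains. It is needed because Mayer-Vietoris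
    lowers the degree by one. *)
Lemma mccord_augmented (A : set X) n s c : mccord A ->
  s \in NC A n -> dl R s = 0 -> c \in chains_in A n -> cone_cycle c s ->
  exists t d, [/\ t \in NC A n.+1, d \in chains_in A n.+1, dl R t = s &
    c - order_chain n t = bd n.+1 d].
Proof.
case: n c => [|n] c MA sA ds cA cs; last exact: MA.
have [t tA tc] := order_chain0_surj cA; exists t, 0; split=> //; first exact: rpred0.
  rewrite -(augmentation_order_chain K) ?tc //.
  by apply: supportedS tA; exact: nerveS.
by rewrite tc subrr linear0.
Qed.

(* Mayer-Vietoris for the mapping cone. *)
Lemma mccord_union (A U V : set X) : open U -> open V -> A `<=` U `|` V ->
  (forall n, nerve A n `<=` nerve (A `&` U) n `|` nerve (A `&` V) n) ->
  mccord (A `&` U) -> mccord (A `&` V) -> mccord (A `&` U `&` V) -> mccord A.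
Proof.
move=> oU oV AUV NUV MU MV MW n s c sA ds cA bc.
set AU := A `&` U in MU *; set AV := A `&` V in MV *.
set AW := A `&` U `&` V in MW.
have UA : AU `<=` A by move=> x [].
have VA : AV `<=` A by move=> x [].
have NCI m u : u \in NC AU m -> u \in NC AV m -> u \in NC AW m.
  move=> uU uV; apply: supportedS (supportedI uU uV).
  move=> r [[rs rU rn] [_ rV _]]; split=> // x xr.
  by have [? ?] := rU x xr; have [? ?] := rV x xr.
have chI m u : u \in chains_in AU m -> u \in chains_in AV m ->
    u \in @chains_in K R X AW m.
  rewrite !chains_in_supported => uU uV; apply: supportedS (supportedI uU uV).
  move=> r [rU rV] x xr.
  by have [? ?] := rU x xr; have [? ?] := rV x xr.
have [sU sUU sVV] := supported_split (supportedS (NUV n.+1) sA).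
set sV := s - sU in sVV.
have bcS : bd n.+1 c \in small AU AV n.
  rewrite bc; have -> : s = sU + sV by rewrite addrC subrK.
  rewrite linearD rpredD //.
    have := order_chain_in K n sUU; rewrite chains_in_supported.
    by apply: supportedS => r; left.
  have := order_chain_in K n sVV; rewrite chains_in_supported.
  by apply: supportedS => r; right.
(* Up to a boundary [c] splits along the cover; [s] splits without subdivision, by the hypothesis on
   nerves. *)
have [d0 d0A] := small_chains oU oV AUV cA bcS.
move=> /small_split[cU cUU]; set cV := (_ - cU) => cVV.
(* The singular part of the mapping-cone boundary of [(cU, sU)], as in the connecting homomorphism.
   Being minus that of [(cV, sV)], it lies over the intersection. *)
pose e := bd n.+1 cU - order_chain n sU.
have bcUV : bd n.+1 cU + bd n.+1 cV = order_chain n sU + order_chain n sV.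
  rewrite -!linearD; have -> : cU + cV = c - bd n.+2 d0 by rewrite addrC subrK.
  have -> : sU + sV = s by rewrite addrC subrK.
  by rewrite linearB boundary_boundary subr0.
have eV : e = order_chain n sV - bd n.+1 cV.
  by apply/eqP; rewrite subr_eq addrAC eq_sym subr_eq bcUV addrC.
have dsUV : dl R sV = - dl R sU by rewrite linearB ds sub0r.
have eW : e \in chains_in AW n.
  apply: chI; first by rewrite rpredB ?boundary_in // (order_chain_in _ _ sUU).
  by rewrite eV rpredB ?boundary_in // (order_chain_in _ _ sVV).
have aW : - dl R sU \in NC AW n.
  apply: NCI; first by rewrite rpredN; exact: dl_nerve sUU.
  by rewrite -dsUV; exact: dl_nerve sVV.
have cycle_e : cone_cycle e (- dl R sU).
  by apply: cone_cycle_sub; apply: supportedS sUU; exact: nerveS.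
have da : dl R (- dl R sU) = 0 by rewrite linearN dl_dl oppr0.
have [t [d [tW dW dt ed]]] := mccord_augmented MW aW da eW cycle_e.
have WU : AW `<=` AU by move=> x [].
have WV : AW `<=` AV by move=> x [[]].
have WUn := supportedS (@nerveS _ _ _ n.+1 WU).
have WVn := supportedS (@nerveS _ _ _ n.+1 WV).
(* Correcting by the filling [(d, t)] over the intersection turns the two halves into cycles over
   [AU] and [AV]. *)
have [tU [dU [tUU dUU dtU eU]]] : exists t1 d1, [/\ t1 \in NC AU n.+2,
    d1 \in chains_in AU n.+2, dl R t1 = sU + t &
    cU - d - order_chain n.+1 t1 = bd n.+2 d1].
  apply: MU; first by rewrite rpredD // WUn.
  - by rewrite linearD dt subrr.
  - by rewrite rpredB // (chains_inS WU dW).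
  - by rewrite linearB -ed opprB addrCA /e subKr addrC [RHS]linearD.
have [tV [dV [tVV dVV dtV eqV]]] : exists t1 d1, [/\ t1 \in NC AV n.+2,
    d1 \in chains_in AV n.+2, dl R t1 = sV - t &
    cV + d - order_chain n.+1 t1 = bd n.+2 d1].
  apply: MV; first by rewrite rpredB // WVn.
  - by rewrite linearB dt dsUV subrr.
  - by rewrite rpredD // (chains_inS WV dW).
  - by rewrite linearD -ed eV addrA (addrC (bd _ cV)) subrK [RHS]linearB.
exists (tU + tV), (d0 + dU + dV); split.
- by rewrite rpredD //; [apply: supportedS tUU|apply: supportedS tVV];
    exact: nerveS.
- by rewrite !rpredD //; [apply: chains_inS dUU|apply: chains_inS dVV].
- by rewrite linearD dtU dtV addrACA subrr addr0 addrC subrK.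
have -> : c = bd n.+2 d0 + cU + cV.
  by rewrite /cV -[c - _ - _]addrA -opprD [RHS]addrC subrK.
clearbody cV; rewrite !(linearD (bd n.+2)) (linearD (order_chain n.+1)) -eU -eqV -!addrA.
congr (_ + (_ + _)); rewrite [RHS]addrCA (addrCA cV d) addKr addrCA.
by rewrite opprD.
Qed.

(* For x minimal in A, split A into the part above x, a cone, and the part outside
   the closure of x; the latter and the intersection are smaller than A. *)
Lemma mccord_finite (A : set X) : mccord A.
Proof.
have /finite_seqP[l0 l0A] : finite_set A by exact: sub_finite_set finX.
have {l0 l0A} [l lA] : exists l : seq X, A `<=` [set` l] by exists l0; rewrite l0A.
have [k] := ubnP (size l); elim: k l A lA => // k IH l A lA lk.
have [[x0 Ax0]|A0] := pselect (A !=set0); last first.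
  move=> n s c sA _ cA _; exists 0, 0; split; rewrite ?rpred0 //.
    rewrite linear0; apply/esym; apply: supported0 sA => -[|y r] [_ rA //] _.
    by apply: A0; exists y; apply: rA; rewrite mem_head.
  rewrite !linear0 addr0; rewrite chains_in_supported in cA; apply: supported0 cA => r rA.
  by apply: A0; exists (r (basis K ord0)); apply: rA; exists (basis K ord0).
have [x Ax xmin] := minimal_spec (sub_finite_set (@subsetT _ A) finX)
  (ex_intro _ x0 Ax0).
pose U := [set y | spec_le x y]; pose V := ~` closure [set x].
have oU : open U by exact: open_up.
have oV : open V by apply: closed_openC; exact: closed_closure.
have smaller B : B `<=` A -> ~ B x -> mccord B.
  move=> BA Bx; apply: (IH [seq y <- l | y != x]).
    move=> y By; rewrite /= mem_filter /=; apply/andP; split; last exact/lA/BA.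
    by apply/eqP => yx; apply: Bx; rewrite -yx.
  rewrite -ltnS (leq_trans _ lk) // ltnS size_filter.
  rewrite ltn_neqAle count_size andbT -all_count; apply/allPn.
  by exists x; rewrite /= ?eqxx //; exact: lA.
have Vx : ~ V x by apply; exact: subset_closure.
apply: (mccord_union oU oV).
- move=> y Ay; have [|yV] := pselect (closure [set x] y); last by right.
  by move=> /closure1P yx; left; exact: xmin.
- move=> n s [ss sA sn].
  (* A chain meeting the closure of [x] lies wholly above [x]: its members are comparable to the one
     below [x], and minimality reverses the inequalities. *)
  have [[y ys yx]|nsx] := pselect (exists2 y, y \in s & spec_le y x); last first.
    right; split=> // y ys; split; first exact: sA.
    by move=> /closure1P yx; apply: nsx; exists y.
  left; split=> // z zs; split; first exact: sA.
  have xy := xmin _ (sA _ ys) yx.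
  have /orP[zy|yz] := sorted_comparable ss zs ys.
  - by apply: xmin; [exact: sA|exact: spec_le_trans yx].
  - exact: spec_le_trans xy yz.
- apply: (@mccord_min _ x); first by split=> //; exact: spec_le_refl.
  by move=> y [].
- by apply: smaller => [y []|[]].
- by apply: smaller => [y [[]]|[]].
Qed.

End McCord.

(** * Acyclic carriers *)

(* Scaling by a sign is linear even if R is not commutative. *)
Definition signl (R : nzRingType) (V : lmodType R) (b : bool) :
  {linear V -> V} := if b return {linear V -> V} then -%R else idfun.

Lemma signlK (R : nzRingType) (V : lmodType R) b : involutive (@signl R V b).
Proof. by case: b => v //=; rewrite opprK. Qed.

Lemma linear_signl (R : nzRingType) (U V : lmodType R) (f : {linear U -> V}) b u :
  f (signl U b u) = signl V b (f u).
Proof. by case: b => //=; rewrite linearN. Qed.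

Section Carriers.
Variables (R : nzRingType).
Local Notation sgl b := (signl (lchain R _) b).
Local Notation NC A n := (supported R (nerve A n)).

Lemma sorted_last (X : topologicalType) (a : X) s y :
  sorted (@spec_le X) (a :: s) -> y \in a :: s -> spec_le y (last a s).
Proof.
move=> ss ys; have := sorted_leq_nth (@spec_le_trans X) (@spec_le_refl X) a ss.
move=> /(_ (index y (a :: s)) (size s)); rewrite !inE !index_mem nth_index //.
rewrite ltnSn -[size s]/((size (a :: s)).-1) nth_last.
by apply; rewrite // -ltnS index_mem.
Qed.

(** Reduced acyclicity, indexed by length: the case [n = 0] says that the empty sequence bounds,
    i.e. that the set is non-empty. *)
Definition lacyclic (X : topologicalType) (A : set X) :=
  forall n s, s \in NC A n -> dl R s = 0 ->
  exists2 t, t \in NC A n.+1 & dl R t = s.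

Section Max.
Variables (X : topologicalType) (x : X).

(** A maximum has to be added at the end to keep sequences sorted, at the price of a sign that
    depends on the length. *)
Definition rcone : {linear lchain R X -> lchain R X} :=
  fglift (fun s : seq X => << rcons s x >> : lchain R X).

Lemma rconeU s : rcone << s >> = << rcons s x >>.
Proof. exact: fgliftU. Qed.

Lemma rcone_cone a c : rcone (cone R a c) = cone R a (rcone c).
Proof.
apply: (freeg_linear_ext (f := rcone \o cone R a) (g := cone R a \o rcone)).
by move=> s; rewrite /= coneU !rconeU coneU.
Qed.

Lemma dseq_rcons s :
  dseq R (rcons s x) = rcone (dseq R s) + sgl (odd (size s)) << s >>.
Proof.
elim: s => [|a s IH].
  by rewrite /= dseq_cons !dseq_nil !linear0 addr0 add0r.
rewrite rcons_cons !dseq_cons IH linearB linearD /= rconeU rcone_cone opprD.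
by rewrite addrA linear_signl coneU /=; case: (odd _); rewrite //= opprK.
Qed.

Lemma dl_rcone n c : c \in supported R [set s : seq X | size s = n] ->
  dl R (rcone c) = rcone (dl R c) + sgl (odd n) c.
Proof.
apply: (supported_ext (f := dl R \o rcone)
  (g := (rcone \o dl R) \+ sgl (odd n))) => s <-.
by rewrite /= rconeU !dlU dseq_rcons.
Qed.

Lemma lacyclic_max A : A x -> (forall y, A y -> spec_le y x) -> lacyclic A.
Proof.
move=> Ax Amax n s sA ds; exists (rcone (sgl (odd n) s)).
  have : sgl (odd n) s \in NC A n by case: (odd n); rewrite //= rpredN.
  apply: supported_map => r [rs rA rn].
  rewrite rconeU; apply: supportedU; split; last by rewrite size_rcons rn.
    case: r rs rA {rn} => //= a r rs rA; rewrite rcons_path rs.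
    by apply: Amax; apply: rA; exact: mem_last.
  by move=> y; rewrite mem_rcons inE => /predU1P[->//|]; exact: rA.
rewrite linear_signl linear_signl (@dl_rcone n); last first.
  by apply: supportedS sA => r [].
by rewrite ds linear0 add0r signlK.
Qed.

End Max.

Lemma lmap_nerve (X Y : topologicalType) (f : X -> Y) A B n c :
  continuous f -> (forall x, A x -> B (f x)) -> c \in NC A n ->
  lmap R f c \in NC B n.
Proof.
move=> fc fAB; apply: supported_map => s [ss sA sn].
rewrite lmapU; apply: supportedU; split; last by rewrite size_map.
  by apply: homo_sorted ss => x y; exact: spec_le_continuous.
by move=> _ /mapP[x xs ->]; apply: fAB; exact: sA.
Qed.

(* Acyclic carriers: [k = 0], [b = false] yields a chain map, and [k = 1],
   [b = true] a homotopy from 0 to [g]. *)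
Section CarrierLemma.
Variables (X Y : topologicalType) (Q : set X) (D : seq X -> set Y).
Variables (k : nat) (b : bool) (u0 : lchain R Y).
Variable g : {linear lchain R X -> lchain R Y}.
Hypothesis D_sub : forall s t, subseq t s -> D t `<=` D s.
Hypothesis D_acyclic : forall n s, nerve Q n.+1 s -> lacyclic (D s).
Hypothesis u0D : u0 \in NC (D [::]) k.
Hypothesis du0 : dl R u0 = g << [::] >>.
Hypothesis gD : forall n s, nerve Q n.+1 s -> g << s >> \in NC (D s) (n + k).
Hypothesis dg : forall n s, nerve Q n.+1 s ->
  dl R (g << s >>) + sgl b (g (dseq R s)) = 0.

Definition carrier_step (s : seq X) (v : lchain R Y) : lchain R Y :=
  xget 0 [set t | t \in NC (D s) (size s + k) /\
    dl R t = g << s >> + sgl b v].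

Definition carried : {linear lchain R X -> lchain R Y} := lrec u0 carrier_step.

(** By induction the prescribed boundary is a cycle in the acyclic carrier of [s], so the choice in
    [carrier_step] succeeds. *)
Lemma carriedP n s : nerve Q n s ->
  carried << s >> \in NC (D s) (n + k) /\
  dl R (carried << s >>) = g << s >> + sgl b (carried (dseq R s)).
Proof.
elim: n s => [|n IH] [|x s] [] //.
  by move=> _ _ _; rewrite lrec_nil dseq_nil !linear0 addr0.
move=> ss sQ sn; have sN : nerve Q n.+1 (x :: s) by [].
set v := carried (dseq R (x :: s)).
have IHface : dseq R (x :: s) \in supported R
    (face_of (x :: s) `&` nerve Q n).
  apply: supportedI; first exact: dseq_face.
  by apply: supportedS (dseq_face R _) => t; exact: (nerve_face sN).
have vD : v \in NC (D (x :: s)) (n + k).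
  apply: supported_map IHface => t [[ts _] tN].
  apply: supportedS (IH t tN).1 => r; apply: nerveS; exact: D_sub.
have dv : dl R v = g (dseq R (x :: s)).
  have : dl R v = g (dseq R (x :: s)) +
      sgl b (carried (dl R (dseq R (x :: s)))).
    apply: (supported_ext (f := dl R \o carried)
      (g := g \+ (sgl b \o (carried \o dl R)))) IHface => t [_ tN].
    by rewrite /= (IH t tN).2 dlU.
  by rewrite dl_dseq !linear0 addr0.
have wD : g << x :: s >> + sgl b v \in NC (D (x :: s)) (n + k).
  by rewrite rpredD ?gD //; move: vD; case: b; rewrite //= rpredN.
have dw : dl R (g << x :: s >> + sgl b v) = 0.
  by rewrite linearD linear_signl dv (dg sN).
have [t tD dt] := D_acyclic sN wD dw.
have := xgetPex 0 (P := [set t | t \in NC (D (x :: s)) (size (x :: s) + k) /\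
  dl R t = g << x :: s >> + sgl b v]).
rewrite /= -/(carrier_step (x :: s) v) -[carrier_step _ _]lrec_cons.
by move: sn => /= [->]; apply; exists t.
Qed.

Lemma carried_dl n c : c \in NC Q n ->
  dl R (carried c) = g c + sgl b (carried (dl R c)).
Proof.
apply: (supported_ext (f := dl R \o carried)
  (g := g \+ (sgl b \o (carried \o dl R)))) => s sN.
by rewrite /= (carriedP sN).2 dlU.
Qed.

Lemma carried_in (A : set X) (B : set Y) n c : A `<=` Q ->
  (forall s, nerve A n s -> D s `<=` B) -> c \in NC A n ->
  carried c \in NC B (n + k).
Proof.
move=> AQ DB; apply: supported_map => s sA.
have [sD _] := carriedP (nerveS AQ sA).
by apply: supportedS sD; apply: nerveS; exact: DB.
Qed.

Lemma carried_nil : carried << [::] >> = u0.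
Proof. exact: lrec_nil. Qed.

End CarrierLemma.
End Carriers.

(** * Homology classes and simplicial acyclicity *)

Section HomologyClass.
Variables (K : realType) (R : nzRingType).
Local Notation bd X := (boundary K R X).

Definition hclass (X : topologicalType) (A : set X * set X) n
    (c : chain K R X n) (h : c \in relcycle A n) : homology K R A n :=
  \pi_(subquot (relcycle A n) (relboundary A n))
    (exist _ c h : submod (relcycle A n)).

Lemma hclassP (X : topologicalType) (A : set X * set X) n
    (x : homology K R A n) : exists c (h : c \in relcycle A n), x = hclass h.
Proof.
exists (val (repr x : submod (relcycle A n))), (valP (repr x)).
rewrite -[LHS]reprK /hclass.
congr (\pi_(subquot (relcycle A n) (relboundary A n)) _); exact/val_inj.
Qed.

Lemma hclass_eq (X : topologicalType) (A : set X * set X) n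
    (c d : chain K R X n) (hc : c \in relcycle A n) (hd : d \in relcycle A n) :
  hclass hc = hclass hd <-> c - d \in relboundary A n.
Proof.
split=> [/subquotP|cd]; first by rewrite raddfB.
by apply/subquotP; rewrite raddfB.
Qed.

Lemma homology_map_hclass (X Y : topologicalType) (A : set X * set X)
    (B : set Y * set Y) (f : pair_map A B) n (c : chain K R X n)
    (hc : c \in relcycle A n) (hf : chain_map K R f n c \in relcycle B n) :
  homology_map K R f n (hclass hc) = hclass hf.
Proof.
rewrite /homology_map /= subquot_map_fun_pi.
congr (\pi_(subquot (relcycle B n) (relboundary B n)) _).
  by apply: val_inj.
exact: chain_map_relboundary.
Qed.

Lemma chain_map_order_chain (X Y : topologicalType) (f : continuousType X Y) n A m c :
  c \in supported R (nerve A m) ->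
  chain_map K R f n (order_chain K R X n c) = order_chain K R Y n (lmap R f c).
Proof.
apply: realize_map => s [ss _ _]; rewrite chain_mapU; congr << _ >>.
apply/continuousEP => t /=.
rewrite !order_simplexE ?tnth_map //.
by apply: homo_sorted ss => x y; apply: spec_le_continuous; exact: cts_fun.
Qed.

Lemma chains_in0 (X : topologicalType) n c :
  (c \in chains_in (set0 : set X) n) = (c == 0 :> chain K R X n).
Proof.
apply/idP/eqP => [|->]; last exact: rpred0.
rewrite chains_in_supported => c0; apply: supported0 c0 => s s0.
by apply: (s0 (s (basis K ord0))); exists (basis K ord0).
Qed.

Lemma min_exact (X : topologicalType) (A : set X) x n c :
  A x -> (forall y, A y -> spec_le x y) -> c \in chains_in A n ->
  @cone_cycle K R X n c 0 -> bd X n.+1 (singular_cone K R x n c) = c.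
Proof.
move=> Ax xA; case: n c => [|n] c cA /= c0.
  exact: (singular_cone_boundary0 xA).
by rewrite (singular_cone_boundaryS xA) // c0 linear0 linear0 !linear0 addr0.
Qed.

Lemma cone_cycle_order_chain (X : topologicalType) n s :
  s \in supported R (nerve setT n.+1) -> dl R s = 0 ->
  @cone_cycle K R X n (order_chain K R X n s) 0.
Proof.
case: n => [|n] sT ds /=; first by rewrite augmentation_order_chain.
by rewrite (order_chain_boundary _ _ sT) ds.
Qed.

(** A simplicial cycle gives a singular one whose image in the point [x] is filled by a cone;
    injectivity in homology makes it bound in [A], and McCord's theorem turns the filling into a
    simplicial one. *)
Lemma acyclic_lacyclic (X : topologicalType) (A : set X) :
  finite_set [set: X] -> acyclic K R A -> lacyclic R A.
Proof.
move=> finX [x Ax H] [|n] s sA ds.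
  exists (cone R x s); last by rewrite dl_cone ds !linear0 addr0.
  apply: supported_map sA => r [_ _ /size0nil ->]; rewrite coneU.
  by apply: supportedU; split=> //= y; rewrite inE => /eqP ->.
have sT : s \in supported R (nerve setT n.+1).
  by apply: supportedS sA; exact: nerveS.
have bphi : bd X n (order_chain K R X n s) = 0.
  case: n s {sA} ds sT => [|n] s ds sT; first exact: boundary0.
  by rewrite (order_chain_boundary _ _ sT) ds linear0.
have hs : order_chain K R X n s \in relcycle (A, set0) n.
  by apply/andP; rewrite /= (order_chain_in _ _ sA) bphi rpred0.
have [g gK _] := H n.
have h0 : (0 : chain K R X n) \in relcycle (A, set0) n by exact: rpred0.
have hf : chain_map K R (point_map A x) n (order_chain K R X n s) \in
    relcycle ([set x], set0) n by exact: chain_map_cycle.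
have hf0 : chain_map K R (point_map A x) n 0 \in relcycle ([set x], set0) n.
  exact: chain_map_cycle.
have /hclass_eq : hclass hs = hclass h0.
  apply: (can_inj gK); rewrite !homology_map_hclass; apply/hclass_eq.
  set z := chain_map K R (point_map A x) n (order_chain K R X n s).
  have zx : z \in chains_in [set x] n by case/andP: hf.
  rewrite linear0 subr0; apply/relboundaryP.
  exists (singular_cone K R x n z).
    by apply: singular_cone_in.
  rewrite (@min_exact _ [set x]) //; first by rewrite subrr rpred0.
    by move=> y ->; exact: spec_le_refl.
  rewrite /z (chain_map_order_chain _ _ sA).
  have smx : lmap R (point_map A x) s \in supported R (nerve setT n.+1).
    by apply: lmap_nerve sA => //; exact: cts_fun.
  by apply: cone_cycle_order_chain => //; rewrite lmap_dl ds linear0.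
move=> /relboundaryP[d dA]; rewrite subr0 chains_in0 subr_eq0 => /eqP pd.
have [t [_ [tA _ dt _]]] := mccord_finite finX sA ds dA (esym pd).
by exists t.
Qed.

End HomologyClass.

(** * A simplicial section of the projection from the graph *)

Section GraphLift.
Variables (R : nzRingType) (X Y : topologicalType) (F : X -> set Y).
Hypothesis monoF : forall x x', spec_le x x' -> F x `<=` F x'.
Hypothesis acyclicF : forall x, lacyclic R (F x).
Local Notation NC A n := (supported R (nerve A n)).

(** The part of the graph over the closure of [x]; it carries the lifts of chains with maximum
    [x]. *)
Definition graph_below (x : X) : set (X * Y) :=
  [set p | spec_le p.1 x /\ F p.1 p.2].

Lemma pair_continuous (x : X) : continuous (fun y : Y => (x, y)).
Proof. by move=> y; apply: cvg_pair; [exact: cvg_cst|exact: cvg_id]. Qed.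

Lemma pair_continuous_l (y : Y) : continuous (fun x : X => (x, y)).
Proof. by move=> x; apply: cvg_pair; [exact: cvg_id|exact: cvg_cst]. Qed.

(* The cycle c is carried by acyclic sets to its image in {x} x F x, where it
   bounds. *)
Lemma graph_below_acyclic x : lacyclic R (graph_below x).
Proof.
move=> n c cG dc.
pose r (p : X * Y) := (x, p.2).
have r_cont : continuous r.
  by move=> p; apply: cvg_pair; [exact: cvg_cst|exact: cvg_snd].
have r_graph p : graph_below x p -> graph_below x (r p).
  by move=> [px Fp]; split; [exact: spec_le_refl|exact: monoF px _ Fp].
have r_ge p : spec_le p.1 x -> spec_le p (r p).
  case: p => a y /= ax.
  exact: (spec_le_continuous (@pair_continuous_l y)).
(* For a chain [s], the set [D s] has the maximum [r (last a s)] and contains both [s] and its image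
   under [r]. *)
pose D (s : seq (X * Y)) : set (X * Y) :=
  [set p | graph_below x p /\ exists2 q, q \in s & spec_le p (r q)].
have D_sub s t : subseq t s -> D t `<=` D s.
  move=> /mem_subseq ts p [pG [q qt pq]]; split=> //.
  by exists q => //; exact: ts.
have D_acyclic m s : nerve (graph_below x) m.+1 s -> lacyclic R (D s).
  case: s => [|a s] [] // ss sG _.
  apply: (@lacyclic_max _ _ (r (last a s))).
    split; first by apply: r_graph; apply: sG; exact: mem_last.
    by exists (last a s); [exact: mem_last|exact: spec_le_refl].
  move=> p [_ [q qs pq]]; apply: (spec_le_trans pq).
  by apply: spec_le_continuous => //; exact: sorted_last.
pose g : {linear lchain R (X * Y)%type -> lchain R (X * Y)%type} := lmap R r \- idfun.
have gD m s : nerve (graph_below x) m.+1 s -> g << s >> \in NC (D s) (m + 1).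
  move=> [ss sG sm]; rewrite addn1 /= lmapU rpredB //; apply: supportedU.
    split; last by rewrite size_map.
      by apply: homo_sorted ss => p q; exact: spec_le_continuous.
    move=> _ /mapP[p ps ->]; split; first exact: r_graph (sG _ ps).
    by exists p => //; exact: spec_le_refl.
  split=> // p ps; split; first exact: sG.
  by exists p => //; apply: r_ge; have [] := sG _ ps.
have dg m s : nerve (graph_below x) m.+1 s ->
    dl R (g << s >>) + signl (lchain R (X * Y)%type) true (g (dseq R s)) = 0.
  by move=> _; rewrite /= linearB lmap_dl dlU subrr.
have g0 : dl R 0 = g << [::] >> by rewrite linear0 /= lmapU subrr.
have u0D : 0 \in NC (D [::]) 1 by exact: rpred0.
have hdl := carried_dl D_sub D_acyclic u0D g0 gD dg cG.
have hin := carried_in D_sub D_acyclic u0D g0 gD dg (A := graph_below x)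
  (B := graph_below x) (fun _ => id) (fun s _ p => @proj1 _ _) cG.
set h := carried _ _ _ _ _ in hdl hin.
have sndF : lmap R (@snd X Y) c \in NC (F x) n.
  apply: lmap_nerve cG; first exact: snd_continuous.
  by move=> p [px Fp]; exact: monoF px _ Fp.
have [|t tF dt] := acyclicF sndF; first by rewrite lmap_dl dc linear0.
exists (lmap R (pair x) t - h c).
  rewrite rpredB //; last by rewrite -addn1.
  apply: lmap_nerve tF; first exact: pair_continuous.
  by move=> y Fy; split=> //=; exact: spec_le_refl.
rewrite linearB /= hdl dc !linear0 addr0 lmap_dl dt /=.
have -> : lmap R (pair x) (lmap R snd c) = lmap R r c.
  apply: (freeg_linear_ext (f := lmap R (pair x) \o lmap R snd) (g := lmap R r)).
  by move=> s; rewrite /= !lmapU -map_comp.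
by rewrite opprB addrC subrK.
Qed.

Lemma graph_below_last a s : sorted (@spec_le X) (a :: s) ->
  [set p | exists2 q, q \in a :: s & graph_below q p] = graph_below (last a s).
Proof.
move=> ss; apply/seteqP; split=> [p [q qs [pq Fp]]|p pG].
  by split=> //; apply: (spec_le_trans pq); exact: sorted_last.
by exists (last a s) => //; exact: mem_last.
Qed.

(** A right inverse of [p_1] up to homotopy: [psi] lifts a chain into the graph below its maximum,
    and [h] is carried by the points below that maximum. Closed sets are down-sets, so one [psi] and
    one [h] respect them all. *)
Lemma graph_lift : exists (psi : {linear lchain R X -> lchain R (X * Y)%type})
    (h : {linear lchain R X -> lchain R X}),
  [/\ forall n c, c \in NC setT n -> dl R (psi c) = psi (dl R c),
    forall (A : set X) n c, closed A -> c \in NC A n ->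
      psi c \in NC (mv_graph F A) n,
    forall (A : set X) n c, closed A -> c \in NC A n -> h c \in NC A n.+1 &
    forall n c, c \in NC setT n ->
    lmap R (@fst X Y) (psi c) - c = dl R (h c) + h (dl R c)].
Proof.
pose D (s : seq X) : set (X * Y) := [set p | exists2 q, q \in s & graph_below q p].
have D_sub s t : subseq t s -> D t `<=` D s.
  by move=> /mem_subseq ts p [q qt pq]; exists q => //; exact: ts.
have D_acyclic m s : nerve [set: X] m.+1 s -> lacyclic R (D s).
  case: s => [|a s] [] // ss _ _; rewrite /D graph_below_last //.
  exact: graph_below_acyclic.
pose g : {linear lchain R X -> lchain R (X * Y)%type} := \0.
have gD m s : nerve [set: X] m.+1 s -> g << s >> \in NC (D s) (m + 0).
  by move=> _; exact: rpred0.
have dg m s : nerve [set: X] m.+1 s ->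
    dl R (g << s >>) + signl (lchain R (X * Y)%type) false (g (dseq R s)) = 0.
  by move=> _; rewrite /= linear0 addr0.
have g0 : dl R << [::] >> = g << [::] >> by rewrite dlU dseq_nil.
have u0D : << [::] >> \in NC (D [::]) 0 by apply: supportedU; split.
pose psi := carried D 0 false << [::] >> g.
have psi_dl n c : c \in NC setT n -> dl R (psi c) = psi (dl R c).
  move=> cT; rewrite (carried_dl D_sub D_acyclic u0D g0 gD dg cT) /=.
  by rewrite add0r.
have psiD n s : nerve setT n s -> psi << s >> \in NC (D s) n.
  move=> sT; rewrite -[n]addn0.
  exact: (carriedP D_sub D_acyclic u0D g0 gD dg sT).1.
have psi_in (A : set X) n c : closed A -> c \in NC A n ->
    psi c \in NC (mv_graph F A) n.
  move=> cA cN; rewrite -[n]addn0.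
  apply: (carried_in D_sub D_acyclic u0D g0 gD dg (@subsetT _ A)) cN.
  move=> s [_ sA _] p [q qs [pq Fp]]; split=> //.
  by apply: closed_spec_le cA pq _; exact: sA.
pose E (s : seq X) : set X := [set y | exists2 q, q \in s & spec_le y q].
have E_sub s t : subseq t s -> E t `<=` E s.
  by move=> /mem_subseq ts p [q qt pq]; exists q => //; exact: ts.
have E_acyclic m s : nerve [set: X] m.+1 s -> lacyclic R (E s).
  case: s => [|a s] [] // ss _ _.
  apply: (@lacyclic_max _ _ (last a s)).
    by exists (last a s); [exact: mem_last|exact: spec_le_refl].
  by move=> y [q qs yq]; apply: (spec_le_trans yq); exact: sorted_last.
pose g' : {linear lchain R X -> lchain R X} :=
  (lmap R (@fst X Y) \o psi) \- idfun.
have gE m s : nerve [set: X] m.+1 s -> g' << s >> \in NC (E s) (m + 1).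
  move=> sT; rewrite addn1 /= rpredB //.
    apply: lmap_nerve (psiD _ _ sT); first exact: fst_continuous.
    by move=> p [q qs [pq _]]; exists q.
  case: sT => ss _ sm; apply: supportedU; split=> // q qs.
  by exists q => //; exact: spec_le_refl.
have psi_dseq m s : nerve [set: X] m s -> dl R (psi << s >>) = psi (dseq R s).
  by move=> sT; rewrite (@psi_dl m) ?dlU //; exact: supportedU.
have dg' m s : nerve [set: X] m.+1 s ->
    dl R (g' << s >>) + signl (lchain R X) true (g' (dseq R s)) = 0.
  by move=> sT; rewrite /= linearB lmap_dl (psi_dseq m.+1) // dlU subrr.
have g'0 : dl R 0 = g' << [::] >>.
  by rewrite linear0 /= [psi _]carried_nil lmapU subrr.
have u0E : 0 \in NC (E [::]) 1 by exact: rpred0.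
exists psi, (carried E 1 true 0 g'); split=> //.
  move=> A n c cA cN; rewrite -(addn1 n).
  apply: (carried_in E_sub E_acyclic u0E g'0 gE dg' (@subsetT _ A)) cN.
  by move=> s [_ sA _] y [q qs yq]; apply: closed_spec_le cA yq _; exact: sA.
move=> n c cT; rewrite (carried_dl E_sub E_acyclic u0E g'0 gE dg' cT) /=.
by rewrite subrK.
Qed.

End GraphLift.

(** * Nilpotent endomorphisms and dynamics *)

Section Nilpotent.
Variables (R : nzRingType) (L : functor (Endo (Mod R)) (Auto (Mod R))).
Hypothesis normalL : normal_functor L.
Hypothesis L0 : isomorphic (L (Endo0 R)) (Auto0 R).

Lemma iso_comp (C : category) (A B D : C) (g : hom B D) (f : hom A B) :
  is_iso g -> is_iso f -> is_iso (compm g f).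
Proof.
move=> [g' [g'g gg']] [f' [f'f ff']]; exists (compm f' g'); split.
  by rewrite compA -(compA f') g'g compm1.
by rewrite compA -(compA g) ff' compm1.
Qed.

Lemma iso_id (C : category) (A : C) : is_iso (idm A).
Proof. by exists (idm A); rewrite comp1m. Qed.

Fixpoint endo_pow (A : Endo (Mod R)) k : hom A A :=
  if k is k'.+1 then compm (endo_self A) (endo_pow A k') else idm A.

Lemma endo_powE (A : Endo (Mod R)) k n x :
  proj1_sig (endo_pow A k) n x = iter k (projT2 A n) x.
Proof. by elim: k x => //= k IH x; rewrite IH. Qed.

Lemma endo_pow_iso (A : Endo (Mod R)) k : is_iso (fmap L (endo_pow A k)).
Proof.
elim: k => [|k IH] /=; first by rewrite fmap1; exact: iso_id.
by rewrite fmap_comp; apply: iso_comp IH; exact: normalL.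
Qed.

Lemma rV0_hom (U : lmodType R) (f g : {linear U -> 'rV[R]_0}) : f = g.
Proof. by apply: linear_ext => u; rewrite [f u]thinmx0 [g u]thinmx0. Qed.

Lemma Auto0_endo (f : hom (Auto0 R) (Auto0 R)) : f = idm (Auto0 R).
Proof.
apply: endo_homP; apply: functional_extensionality_dep => n.
exact: rV0_hom.
Qed.

Lemma zero_from (A : Endo (Mod R)) : hom (Endo0 R) A.
Proof.
exists (fun n => \0 : {linear 'rV[R]_0 -> projT1 A n}).
apply: functional_extensionality_dep => n; apply: linear_ext => u /=.
by rewrite linear0.
Defined.

Lemma zero_to (A : Endo (Mod R)) : hom A (Endo0 R).
Proof.
exists (fun n => \0 : {linear projT1 A n -> 'rV[R]_0}).
by apply: functional_extensionality_dep => n; exact: rV0_hom.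
Defined.

Lemma nilpotent_zero (A : Endo (Mod R)) k :
  (forall n x, iter k (projT2 A n) x = 0) -> isomorphic (L A) (Auto0 R).
Proof.
move=> Ak; have [i [j [ji ij]]] := L0.
have powE : endo_pow A k = compm (zero_from A) (zero_to A).
  apply: endo_homP; apply: functional_extensionality_dep => n.
  by apply: linear_ext => x; rewrite endo_powE Ak.
have [p [pk kp]] := endo_pow_iso A k.
exists (compm i (fmap L (zero_to A))).
(* Inverting [L] of the power makes [L A] a retract of [L (Endo0 R)]; the other composite is an
   endomorphism of the zero object, hence the identity. *)
exists (compm p (compm (fmap L (zero_from A)) j)); split; last exact: Auto0_endo.
by rewrite -!compA (compA j) ji comp1m -fmap_comp -powE.
Qed.

End Nilpotent.

Section Dynamics.
Variables (X : topologicalType) (finX : finite_set [set: X]).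

(** Otherwise every point leaves at some stage, and the set at the maximum of these stages is
    empty. *)
Lemma finite_decreasing (Q : nat -> set X) :
  (forall k, Q k.+1 `<=` Q k) -> (forall k, Q k !=set0) ->
  exists x, forall k, Q k x.
Proof.
move=> Qdecr Q0; have Qle k m : (k <= m)%N -> Q m `<=` Q k.
  elim: m => [|m IH]; first by rewrite leqn0 => /eqP ->.
  rewrite leq_eqVlt => /predU1P[-> //|/IH mk].
  exact: subset_trans (Qdecr m) mk.
apply: contrapT => nQ.
have H x : exists k, ~ Q k x.
  apply: contrapT => nk; apply: nQ; exists x => k; apply: contrapT => Qk.
  by apply: nk; exists k.
have [N NQ] := choice H.
have /finite_seqP[l lT] := finX.
have [x xQ] := Q0 (\max_(y <- l) N y)%N.
apply: (NQ x); apply: Qle xQ.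
by apply: leq_bigmax_seq => //; have : [set: X] x by []; rewrite lT.
Qed.

Lemma periodic_solution (F : X -> set X) (D : set X) : D !=set0 ->
  (forall x, D x -> exists2 y, D y & F x y) -> invariant_set F D !=set0.
Proof.
move=> [x0 Dx0] DF.
have H x : exists y, D x -> D y /\ F x y.
  have [Dx|nDx] := pselect (D x); last by exists x.
  by have [y Dy Fy] := DF x Dx; exists y.
have [g gP] := choice H.
have orbit m x : D x -> D (iter m g x).
  by move=> Dx; elim: m => //= m IH; have [] := gP _ IH.
have /finite_seqP[l lT] := finX.
(* One iterate more than there are entries in an enumeration of [X], so two coincide. *)
pose s := [seq iter m g x0 | m <- iota 0 (size l).+1].
have : ~~ uniq s.
  apply/negP => us; have : (size s <= size l)%N.
    apply: uniq_leq_size us _ => y _; have : [set: X] y by [].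
    by rewrite lT.
  by rewrite size_map size_iota ltnn.
move=> /(uniqPn x0)[i [j [ij]]]; rewrite size_map size_iota => js.
rewrite !(nth_map 0%N) ?size_iota ?nth_iota ?(ltn_trans ij js) // !add0n => E.
pose y := iter i g x0; pose p := (j - i)%N.
have p0 : (0 < p)%N by rewrite subn_gt0.
have Dy : D y by exact: orbit.
have py : iter p g y = y by rewrite -iterD subnK // ltnW.
have modp m : iter (m %% p) g y = iter m g y.
  rewrite {2}(divn_eq m p) addnC iterD; congr (iter _ _ _).
  by elim: (m %/ p)%N => //= q IH; rewrite mulSn iterD -IH.
(* Integer remainders are non-negative, so the cycle is also run through at negative times. *)
pose sol (z : int) := iter `|(z %% p)%Z|%N g y.
have solS z : sol (z + 1) = g (sol z).
  rewrite /sol -modzDml; have [a ->] : exists a : nat, (z %% p)%Z = a.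
    by exists `|(z %% p)%Z|%N; rewrite gez0_abs // modz_ge0 // eqz_nat -lt0n.
  by rewrite -PoszD modz_nat absz_nat modp addn1.
exists y; exists sol; last by exists 0; rewrite // /sol mod0z.
move=> z; have Dz : D (sol z) by exact: orbit.
by split=> //; rewrite solS; have [] := gP _ Dz.
Qed.

End Dynamics.

(** * The index map *)

Lemma linvK (R : nzRingType) (U V : lmodType R) (f : {linear U -> V}) u :
  bijective f -> linv f (f u) = u.
Proof.
move=> fbij; rewrite /linv /= /linv_fun; case: asboolP => // -[g fK _].
by apply: xget_unique => [//|v /= /(can_inj fK)].
Qed.

Lemma linv_nbij (R : nzRingType) (U V : lmodType R) (f : {linear U -> V}) v :
  ~ bijective f -> linv f v = 0.
Proof. by move=> nf; rewrite /linv /= /linv_fun; case: asboolP. Qed.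

Section RelativeMcCord.
Variables (K : realType) (R : nzRingType) (X : topologicalType).
Local Notation order_chain := (@order_chain K R X).
Local Notation bd := (@boundary K R X).
Local Notation NC A n := (supported R (@nerve X A n)).

Lemma nerve0 (A B : set X) : nerve A 0 `<=` nerve B 0.
Proof. by move=> s [_ _ /size0nil ->]; split. Qed.

Lemma order_chain_relcycle (A B : set X) n u : u \in NC A n.+1 -> dl R u \in NC B n ->
  order_chain n u \in relcycle (A, B) n.
Proof.
move=> uA uB; apply/andP; split; first exact: (order_chain_in _ _ uA).
case: n uA uB => [|n] uA uB; first by rewrite boundary0 rpred0.
by rewrite (order_chain_boundary _ _ uA); exact: (order_chain_in _ _ uB).
Qed.

Hypothesis finX : finite_set [set: X].

(** McCord over [B] makes the boundary simplicial up to a correction [d]; McCord over [A] then makes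
    [c - d] simplicial. No long exact sequence is involved. *)
Lemma relative_mccord (A B : set X) n c : B `<=` A ->
  c \in relcycle (A, B) n -> exists u, [/\ u \in NC A n.+1, dl R u \in NC B n &
    c - order_chain n u \in relboundary (A, B) n].
Proof.
move=> BA /andP[/= cA cB]; case: n c cA cB => [|n] c cA cB.
  have [u uA uc] := order_chain0_surj cA; exists u; split=> //.
    by apply: supportedS (dl_nerve uA); exact: nerve0.
  by rewrite uc subrr rpred0.
have cyc : cone_cycle (bd n.+1 c) 0.
  case: n c {cA cB} => [|n] c /=; first exact: augmentation_boundary.
  by rewrite boundary_boundary linear0.
have [b [d [bB dB db bd_d]]] := mccord_augmented (@mccord_finite K R X finX B)
  (rpred0 _) (linear0 _) cB cyc.
have cdA : c - d \in chains_in A n.+1 by rewrite rpredB // (chains_inS BA dB).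
have bA : b \in NC A n.+1 by apply: supportedS bB; exact: nerveS.
have bcd : bd n.+1 (c - d) = order_chain n b by rewrite linearB -bd_d subKr.
have [t [e [tA eA dt te]]] := @mccord_finite K R X finX A n b _ bA db cdA bcd.
exists t; split=> //; first by rewrite dt.
apply/relboundaryP; exists e => //=.
by rewrite -te opprB addrA subrK opprB addrC subrK.
Qed.

End RelativeMcCord.

Section IndexMap.
Variables (K : realType) (R : nzRingType) (X : topologicalType).
Variables (finX : finite_set [set: X]) (F : X -> set X).
Hypothesis monoF : forall x x', spec_le x x' -> F x `<=` F x'.
Hypothesis acyclicF : forall x, lacyclic R (F x).
Variables P1 P2 : set X.
Hypotheses (closedP1 : closed P1) (closedP2 : closed P2) (P21 : P2 `<=` P1).
Hypothesis P_exit :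
  P1 `&` (closure (mv_image F P1 `\` P1) `|` mv_image F P2) `<=` P2.
Local Notation E := (exit_closure F (P1, P2)).
Local Notation order_chain := (@order_chain K R _).
Local Notation NC A n := (supported R (nerve A n)).

Lemma exit_sub x : P1 x -> E x -> P2 x.
Proof. by move=> Px Ex; apply: P_exit; split=> //; left. Qed.

Lemma nerve_closedU (A B : set X) n : closed A -> closed B ->
  nerve (A `|` B) n `<=` nerve A n `|` nerve B n.
Proof.
move=> cA cB [|a s] [ss sAB sn]; first by left; split.
have [lA|lB] := sAB _ (mem_last a s); [left|right]; split=> // x xs.
  by apply: closed_spec_le cA (sorted_last ss xs) lA.
by apply: closed_spec_le cB (sorted_last ss xs) lB.
Qed.

(** Stands for the image of the homology of [(A, P2)] in that of [(P1, P2)], through simplicial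
    representatives. *)
Definition carried_by (A : set X) n (x : homology K R (P1, P2) n) :=
  exists u (h : order_chain n u \in relcycle (P1, P2) n),
    [/\ u \in NC A n.+1, dl R u \in NC P2 n & x = hclass h].

Lemma carried_by0 A n : carried_by A (0 : homology K R (P1, P2) n).
Proof.
have h : order_chain n 0 \in relcycle (P1, P2) n by rewrite linear0 rpred0.
exists 0, h; split; rewrite ?linear0 ?rpred0 //.
rewrite -subquot_pi0; apply/subquotP; rewrite sub0r raddfN rpredN /=.
by rewrite linear0 rpred0.
Qed.

Lemma carried_by_P2 n x : @carried_by P2 n x -> x = 0.
Proof.
move=> [u [h [uP _ ->]]]; rewrite -subquot_pi0; apply/subquotP.
rewrite subr0 /=; apply/relboundaryP; exists 0; first exact: rpred0.
by rewrite !linear0 addr0 (order_chain_in _ _ uP).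
Qed.

Lemma carried_by_P1 n x : @carried_by P1 n x.
Proof.
have [c [hc ->]] := hclassP x.
have [u [uA uB cu]] := relative_mccord finX P21 hc.
have h : order_chain n u \in relcycle (P1, P2) n by exact: order_chain_relcycle.
by exists u, h; split=> //; apply/hclass_eq.
Qed.

(* If one of the maps to be inverted is not bijective, [linv] is 0 and there is
   nothing to prove; so only the surjectivity of the Vietoris and excision maps
   for (A', P2) and (A, P2) matters, and it is obtained simplicially. *)
Lemma carried_by_step (A A' : set X) n x :
  closed A -> closed A' -> P2 `<=` A -> A `<=` P1 -> P2 `<=` A' -> A' `<=` P1 ->
  mv_image F A' `<=` A `|` E ->
  @carried_by A' n x -> carried_by A (index_map (P := (P1, P2)) P21 P_exit K R n x).
Proof.
move=> cA cA' P2A AP1 P2A' A'P1 FA' [u [h [uA' uP2 xh]]].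
set f1 := homology_map K R (mv_proj1 F (P1, P2)) n.
set f2 := homology_map K R (bar_incl F (P1, P2)) n.
set f3 := homology_map K R
  (mv_proj2 (mv_pair_bar (P := (P1, P2)) P21 P_exit)) n.
have -> : index_map (P := (P1, P2)) P21 P_exit K R n x =
  linv f2 (f3 (linv f1 x)) by [].
have [bij1|nbij1] := pselect (bijective f1); last first.
  rewrite (linv_nbij _ nbij1) (linear0 f3) (linear0 (linv f2)); exact: carried_by0.
have [bij2|nbij2] := pselect (bijective f2); last first.
  by rewrite (linv_nbij _ nbij2); exact: carried_by0.
have [psi [H [psi_dl psi_in H_in H_htpy]]] := graph_lift monoF acyclicF.
have uT : u \in NC setT n.+1 by apply: supportedS uA'; exact: nerveS.
have dpsi := psi_dl _ _ uT.
have wA' := psi_in A' _ _ cA' uA'.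
have wP2 := psi_in P2 _ _ closedP2 uP2; rewrite -dpsi in wP2.
have hw : order_chain n (psi u) \in relcycle (mv_graph_pair F (P1, P2)) n.
  apply: order_chain_relcycle => //; apply: supportedS wA'; apply: nerveS.
  by move=> p [Ap Fp]; split=> //; exact: A'P1.
have hp1 := chain_map_cycle (mv_proj1 F (P1, P2)) hw.
have p1w : chain_map K R (mkcts (@fst_continuous X X)) n (order_chain n (psi u)) =
    order_chain n (lmap R fst (psi u)) by rewrite (chain_map_order_chain K _ _ wA').
(* [H] relates [u] to the projection of its lift; the term [H (dl R u)] stays in [P2] because [P2]
   is closed. *)
have x1 : x = f1 (hclass hw).
  rewrite xh /f1 (homology_map_hclass hw hp1); apply/esym/hclass_eq.
  rewrite [chain_map _ _ _ _ _]p1w -linearB (H_htpy _ _ uT) linearD.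
  rewrite -(order_chain_boundary K n (H_in _ _ _ cA' uA')).
  apply/relboundaryP; exists (order_chain n.+1 (H u)).
    by apply: chains_inS A'P1 (order_chain_in _ _ (H_in _ _ _ cA' uA')).
  by rewrite addrAC subrr add0r (order_chain_in _ _ (H_in _ _ _ closedP2 uP2)).
rewrite x1 linvK //.
have hp2 := chain_map_cycle (mv_proj2 (mv_pair_bar (P := (P1, P2)) P21 P_exit)) hw.
rewrite /f3 (homology_map_hclass hw hp2).
pose v := lmap R snd (psi u).
have p2w : chain_map K R (mkcts (@snd_continuous X X)) n (order_chain n (psi u)) =
    order_chain n v by rewrite (chain_map_order_chain K _ _ wA').
have cE : closed E by exact: closed_closure.
have vA : v \in NC (A `|` E) n.+1.
  apply: lmap_nerve wA'; first exact: snd_continuous.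
  by move=> p [Ap Fp]; apply: FA'; exists p.1.
have dvP : dl R v \in NC (P2 `|` E) n.
  rewrite lmap_dl; apply: lmap_nerve wP2; first exact: snd_continuous.
  move=> p [Ap Fp]; apply: (mv_pair_bar (P := (P1, P2)) P21 P_exit).2.
  by exists p.1.
(* Excision: the part of [v] in [E] vanishes relative to the second set of [bar_pair]. *)
have [v1 v1A v2E] := supported_split (supportedS (nerve_closedU cA cE) vA).
(* The boundary lies in [A] and in the union of [P2] and [E]; as [A] is inside [P1], [exit_sub]
   leaves only [P2]. *)
have dv1 : dl R v1 \in NC P2 n.
  have dv1A : dl R v1 \in NC A n by exact: dl_nerve v1A.
  have dv1P : dl R v1 \in NC (P2 `|` E) n.
    have -> : dl R v1 = dl R v - dl R (v - v1) by rewrite linearB subKr.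
    rewrite rpredB //; apply: supportedS (dl_nerve v2E).
    by apply: nerveS => y Ey; right.
  apply: supportedS (supportedI dv1A dv1P) => r [[rs rA rn] [_ rP _]].
  split=> // y yr; have [//|Ey] := rP y yr.
  by apply: exit_sub => //; apply: AP1; exact: rA.
have h' : order_chain n v1 \in relcycle (P1, P2) n.
  by apply: order_chain_relcycle => //; apply: supportedS v1A; exact: nerveS.
exists v1, h'; split=> //.
have hi := chain_map_cycle (bar_incl F (P1, P2)) h'.
have iv1 : chain_map K R (bar_incl F (P1, P2)) n (order_chain n v1) = order_chain n v1.
  rewrite (chain_map_order_chain K _ _ v1A).
  congr (order_chain n _); apply: (freeg_linear_ext (f := lmap R idfun) (g := idfun)).
  by move=> s /=; rewrite lmapU map_id.
rewrite -[RHS](linvK _ bij2); congr (linv f2 _).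
rewrite /f2 (homology_map_hclass h' hi); apply/hclass_eq.
rewrite iv1 [chain_map _ _ _ _ _]p2w -linearB.
apply/relboundaryP; exists 0; first exact: rpred0.
rewrite !linear0 addr0; apply: chains_inS (order_chain_in _ _ v2E).
by move=> y Ey; right.
Qed.

(* Closed because F is lower semicontinuous; a point of P1 outside step k.+1 has
   a successor in P1 outside step k. *)
Fixpoint filtration k : set X :=
  if k is k'.+1 then [set x | P1 x /\ F x `<=` filtration k' `|` E] else P2.

Lemma filtration_sub k : filtration k `<=` P1.
Proof. by case: k => //= k x []. Qed.

Hypothesis lscF : lower_semicontinuous F.

Lemma filtration_closed k : closed (filtration k).
Proof.
elim: k => //= k IH; apply: (closedI closedP1).
by apply: lscF; apply: closedU => //; exact: closed_closure.
Qed.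

Lemma filtration_P2 k : P2 `<=` filtration k.
Proof.
elim: k => //= k IH x Px; split; first exact: P21.
move=> y Fy; have [||] := (mv_pair_bar (P := (P1, P2)) P21 P_exit).2 y.
- by exists x.
- by move=> /IH; left.
- by right.
Qed.

Lemma filtration_S k : filtration k `<=` filtration k.+1.
Proof.
elim: k => [|k IH]; first exact: (filtration_P2 1).
move=> x [Px Fx]; split=> // y /Fx[|]; [left|by right].
exact: IH.
Qed.

Lemma carried_by_iter k n x : @carried_by (filtration k) n x ->
  iter k (index_map (P := (P1, P2)) P21 P_exit K R n) x = 0.
Proof.
elim: k x => [|k IH] x; first exact: carried_by_P2.
move=> xk; rewrite iterSr; apply: IH.
apply: (@carried_by_step _ (filtration k.+1)) xk.
- exact: filtration_closed.
- exact: filtration_closed.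
- exact: filtration_P2.
- exact: filtration_sub.
- exact: (filtration_P2 k.+1).
- exact: filtration_sub.
- by move=> y [z [_ Fz] Fzy]; exact: Fz.
Qed.

Lemma filtration_top : invariant_set F (P1 `\` P2) = set0 ->
  exists k, P1 `<=` filtration k.
Proof.
move=> I0; apply: contrapT => nk.
pose D k := P1 `\` filtration k.
have [x xD] : exists x, forall k, D k x.
  apply: (finite_decreasing finX) => k.
    by move=> x [Px nx]; split=> // xk; apply: nx; exact: filtration_S.
  apply: contrapT => Dk; apply: nk; exists k => y Py; apply: contrapT => ny.
  by apply: Dk; exists y.
(* For each [k] some successor lies outside step [k], but it depends on [k]; the sets of such
   successors decrease, so finiteness yields one for all [k]. *)
have step y : (forall k, D k y) -> exists2 z, (forall k, D k z) & F y z.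
  move=> yD; have [z zD] : exists z, forall k, (D k `&` F y) z.
    apply: (finite_decreasing finX) => k.
      move=> z [[Pz nz] Fz]; split=> //; split=> // zk; apply: nz.
      exact: filtration_S.
    have [Py nyk] := yD k.+1; apply: contrapT => nz; apply: nyk; split=> //.
    move=> z Fz; have [Pz|nPz] := pselect (P1 z); last first.
      right; apply: subset_closure; split=> //; by exists y.
    left; apply: contrapT => nzk; apply: nz; exists z; split=> //.
  by exists z => [k|]; [have [] := zD k|have [] := zD 0%N].
have [|y [s sol sy]] := periodic_solution finX (F := F)
  (D := [set y | forall k, D k y]) _ step; first by exists x.
suff : invariant_set F (P1 `\` P2) y by rewrite I0.
by exists s => // i; have [sD Fs] := sol i; split=> //; exact: (sD 0%N).
Qed.

End IndexMap.

Theorem proposition7p1 (K : realType) (R : nzRingType)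
    (X : topologicalType) (finX : finite_set [set: X])
    (T0X : kolmogorov_space X)
    (F : X -> set X) (lscF : lower_semicontinuous F)
    (closedF : forall x, closed (F x))
    (acyclicF : forall x, acyclic K R (F x))
    (L : functor (Endo (Mod R)) (Auto (Mod R)))
    (normalL : normal_functor L)
    (L0 : isomorphic (L (Endo0 R)) (Auto0 R))
    (P1 P2 : set X) (closedP1 : closed P1) (closedP2 : closed P2)
    (P21 : P2 `<=` P1)
    (P_exit : P1 `&` (closure (mv_image F P1 `\` P1) `|` mv_image F P2) `<=` P2) :
  ~ isomorphic (L (index_endo (P := (P1, P2)) P21 P_exit K R)) (Auto0 R) ->
  invariant_set F (P1 `\` P2) !=set0.
Proof.
move=> nL; apply/set0P/eqP => I0; apply: nL.
(* The set of points whose value lies in [F x'] is closed and contains [x'], hence all points below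
   [x']. *)
have monoF x x' : spec_le x x' -> F x `<=` F x'.
  move=> xx'; have H := closed_spec_le (lscF _ (closedF x')) xx'.
  exact: (H (@subset_refl _ (F x'))).
have lacyclicF x : lacyclic R (F x) by exact: acyclic_lacyclic (acyclicF x).
(* [k] is fixed before the degree, since a single power has to vanish on the whole graded module. *)
have [k kP] := filtration_top finX P21 P_exit I0.
apply: (nilpotent_zero normalL L0 (k := k)) => n x.
have fP1 : filtration F P1 P2 k = P1.
  by apply/seteqP; split=> //; exact: filtration_sub.
have xk : carried_by (filtration F P1 P2 k) (x : homology K R (P1, P2) n).
  by rewrite fP1; exact: carried_by_P1.
exact: (carried_by_iter monoF lacyclicF closedP1 closedP2 P21 P_exit lscF xk).
Qed.
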